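(* Fix a deletion probability $q\in(0,1)$. Then the following hold. (1) $\exp(O(n^{3/7}\log^{10/3}n))$ traces suffice to reconstruct, with high probability, an arbitrary matrix $X\in\{0,1\}^{n\times n}$. (2) $\exp(O(n^{5/9}\log^{5/2}n))$ traces suffice to reconstruct, with high probability, an arbitrary $3$-dimensional hypermatrix $X\in\{0,1\}^{n\times n\times n}$. (3) For any fixed dimension $d\ge 4$, $\exp(O(n^{3/5}\log n))$ traces suffice to reconstruct, with high probability, an arbitrary hypermatrix $X\in\{0,1\}^{n^{\times d}}$.
   Context: $\{0,1\}^{n^{\times d}}$ denotes the set of $d$-dimensional hypermatrices with entries in $\{0,1\}$ and side length $n$ in each of the $d$ dimensions; entries are indexed by $(k_1,\dots,k_d)\in\{0,1,\dots,n-1\}^d$. For $1\le i\le d$ and $a\in\{0,\dots,n-1\}$, the slice $(i,a)$ of $X$ is the set of entries with $k_i=a$ (for $d=2$ the slices are the rows and the columns). A trace of $X$ is the random sub-hypermatrix obtained from $X$ by deleting each of its $dn$ slices independently with probability $q$ (the surviving indices in each dimension are kept in their order and relabelled consecutively from $0$; it is not revealed which slices were deleted). ''$\exp(O(\phi(n)))$ traces suffice to reconstruct, with high probability, an arbitrary $X\in\{0,1\}^{n^{\times d}}$'' means: there is a constant $C>0$ (depending only on $q$ and $d$) and, for every $n$, a reconstruction map $R_n$ taking as input $T=\lceil\exp(C\phi(n))\rceil$ hypermatrices and outputting an element of $\{0,1\}^{n^{\times d}}$, such that $$\min_{X\in\{0,1\}^{n^{\times d}}}\ \mathbb{P}\big[R_n(\widetilde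 U^1,\dots,\widetilde U^T)=X\big]\to 1\quad\text{as } n\to\infty,$$ where $\widetilde U^1,\dots,\widetilde U^T$ are independent traces of $X$. *)

(* Defs.v *)
From mathcomp Require Import all_boot all_order all_algebra.
From mathcomp Require Import all_classical all_reals all_analysis.
Set Implicit Arguments.
Unset Strict Implicit.
Unset Printing Implicit Defensive.
Import Order.TTheory GRing.Theory Num.Theory.
Import numFieldNormedType.Exports.
Local Open Scope classical_set_scope.
Local Open Scope ring_scope.

Definition hypermatrix (d : nat) (m : 'I_d -> nat) : Type :=
  {ffun {dffun forall i : 'I_d, 'I_(m i)} -> bool}.

Definition cube (n d : nat) : Type := hypermatrix (fun _ : 'I_d => n).

(* The values of a trace: its side lengths are random and may differ from one
   dimension to another, and they are part of the data. *)
Definition sized_hypermatrix (d : nat) : Type :=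
  {m : 'I_d -> nat & hypermatrix m}.

(* A set [D] of deleted slices consists of pairs [(i, a)], with dimensions [i]
   numbered from 0. *)
Definition survivors (n d : nat) (D : {set 'I_d * 'I_n}) (i : 'I_d) :
    {set 'I_n} :=
  [set a | (i, a) \notin D]%SET.

(* [enum_val] lists the elements of a subset of ['I_n] in increasing order, so
   entry [k] of the trace is the entry of [X] whose [i]-th index is the
   [k i]-th surviving one. *)
Definition trace (n d : nat) (X : cube n d) (D : {set 'I_d * 'I_n}) :
    sized_hypermatrix d :=
  existT (@hypermatrix d) (fun i => #|survivors D i|)
    [ffun k : {dffun forall i : 'I_d, 'I_#|survivors D i|} =>
      X [ffun i => enum_val (k i)]].

Section Reconstruction.
Context {R : realType}.

Definition deletion_prob (q : R) (n d : nat) (D : {set 'I_d * 'I_n}) : R :=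
  \prod_(s : 'I_d * 'I_n) (if s \in D then q else 1 - q).

(* The probability that [rec] returns [X] on [T] independent traces of [X]. *)
Definition success_prob (q : R) (n d T : nat)
    (rec : T.-tuple (sized_hypermatrix d) -> cube n d) (X : cube n d) : R :=
  \sum_(D : {ffun 'I_T -> {set 'I_d * 'I_n}}
         | rec [tuple trace X (D t) | t < T] == X)
    \prod_(t < T) deletion_prob q (D t).

(* Probabilities are at most 1, so starting the iterated minimum at 1 does not
   change its value. *)
Definition min_success_prob (q : R) (n d T : nat)
    (rec : T.-tuple (sized_hypermatrix d) -> cube n d) : R :=
  \big[Num.min/1]_(X : cube n d) success_prob q rec X.

Definition num_traces (C : R) (phi : nat -> R) (n : nat) : nat :=
  `|Num.ceil (expR (C * phi n))|%N.

Definition exp_O_traces_suffice (q : R) (d : nat) (phi : nat -> R) : Prop :=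
  exists2 C : R, 0 < C &
  exists rec : forall n : nat,
      (num_traces C phi n).-tuple (sized_hypermatrix d) -> cube n d,
    min_success_prob q (rec n) @[n --> \oo] --> (1 : R).

End Reconstruction.

(* Main.v *)
(** In each dimension we look for a window of consecutive slices.  A statistic
    of the trace sums, over all tuples of indices of the trace whose entries
    show a prescribed pattern, weights depending on the numbers of trace slices
    before, inside and after the tuple.  Its mean is the sum over all tuples of
    slices of [X] showing the pattern, where a weight [c] turns into its
    binomial mean [m |-> E c(Bin(m, 1 - q))].  Two kinds of weights are used:
    one whose mean is almost the indicator of [m = 0], obtained by expanding
    [1 - q x] in powers of a Blaschke factor, which forces the tuple to be
    consecutive; and one whose mean is a product of even powers of cosines
    concentrated at scale [z] around a given position.

    If [X] and [Y] first differ at [k] in lexicographic order, consider the part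
    of a window around [k] that does not come after [k].  As for one-dimensional
    strings, the patterns of [X] and [Y] on it cannot both have a short period,
    so one of them occurs at most once near [k] in [X] and at most once in [Y],
    and the means of the statistic differ.  With [z] of order [n^(3/7)] all
    weights are [exp(O(n^(3/7) ln n))], so in every dimension that many traces
    separate all pairs, by a Chernoff bound.  This is at most each of the three
    bounds claimed. *)
Require Import Defs.
From mathcomp Require Import all_boot all_order all_algebra.
From mathcomp Require Import all_classical all_reals all_analysis.
From mathcomp Require Import ring lra zify.
Import Order.TTheory GRing.Theory Num.Theory.
Import numFieldNormedType.Exports.
Set Implicit Arguments.
Unset Strict Implicit.
Unset Printing Implicit Defensive.
Local Open Scope classical_set_scope.
Local Open Scope ring_scope.

(** * Binomial means, and weights whose mean is almost the indicator of zero *)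

Section BinomialMeans.
Variables (R : realType) (q : R).
Hypotheses (q0 : 0 < q) (q1 : q < 1).
Local Notation p := (1 - q).

(* [bin_mean c m] is the mean of [c] at a binomial variable with parameters
   [m] and [p]. *)
Fixpoint bin_mean (c : nat -> R) (m : nat) : R :=
  if m is m'.+1 then q * bin_mean c m' + p * bin_mean (fun j => c j.+1) m'
  else c 0.

Lemma eq_bin_mean (c1 c2 : nat -> R) : c1 =1 c2 -> bin_mean c1 =1 bin_mean c2.
Proof.
move=> e m; elim: m c1 c2 e => [|m IH] c1 c2 e /=; first exact: e.
by rewrite (IH _ _ e) (IH (fun j => c1 j.+1) (fun j => c2 j.+1)).
Qed.

Lemma bin_meanD (c1 c2 : nat -> R) a1 a2 m :
  bin_mean (fun j => a1 * c1 j + a2 * c2 j) m =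
  a1 * bin_mean c1 m + a2 * bin_mean c2 m.
Proof.
elim: m c1 c2 => [|m IH] c1 c2 //=.
by rewrite IH (IH (fun j => c1 j.+1) (fun j => c2 j.+1)); ring.
Qed.

Lemma bin_meanZ (c : nat -> R) a m :
  bin_mean (fun j => a * c j) m = a * bin_mean c m.
Proof.
rewrite -[RHS]addr0 -[X in _ + X](mul0r (bin_mean c m)) -bin_meanD.
by apply: eq_bin_mean => j; rewrite mul0r addr0.
Qed.

Lemma bin_mean_cst (a : R) m : bin_mean (fun=> a) m = a.
Proof. by elim: m => [|m IH] //=; rewrite IH; ring. Qed.

(** Multiplies the generating function of [c] by [(1 + q) y - q]. Up to a factor [1 / (1 - q x)],
    binomial means substitute [y = p x / (1 - q x)], which turns this multiplier into the Blaschke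
    factor [(x - q) / (1 - q x)]. *)
Definition blaschke (c : nat -> R) (j : nat) : R :=
  (1 + q) * (if j is j'.+1 then c j' else 0) - q * c j.

Lemma bin_mean_blaschke0 (c : nat -> R) : bin_mean (blaschke c) 0 = - q * c 0.
Proof. by rewrite /= /blaschke mulr0 add0r mulNr. Qed.

Lemma bin_mean_blaschkeS (c : nat -> R) m :
  bin_mean (blaschke c) m.+1 =
  q * bin_mean (blaschke c) m + bin_mean c m - q * bin_mean c m.+1.
Proof.
rewrite /= (@eq_bin_mean (fun j => blaschke c j.+1)
  (fun j => (1 + q) * c j + - q * c j.+1)); last first.
  by move=> j; rewrite /blaschke; ring.
rewrite bin_meanD; ring.
Qed.

(** A Blaschke factor has modulus 1 on the unit circle, so multiplication by it preserves the l2
    norm of the coefficients. On partial sums the recurrence telescopes, and the loss is a single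
    square up to the factor [1 - q ^+ 2]. *)
Lemma blaschke_norm_le (g g' : nat -> R) M :
  g' 0 = - q * g 0 ->
  (forall m, g' m.+1 = q * g' m + g m - q * g m.+1) ->
  \sum_(m < M) g' m ^+ 2 <= \sum_(m < M) g m ^+ 2.
Proof.
move=> g0 gS; pose A m := g m + q * g' m.
suff H : (1 - q ^+ 2) * (\sum_(m < M) g' m ^+ 2 - \sum_(m < M) g m ^+ 2)
         = (if M is M'.+1 then - A M' ^+ 2 else 0).
  have q2 : 0 < 1 - q ^+ 2 by rewrite subr_gt0 expr_lt1 // ltW.
  rewrite -subr_le0 -(pmulr_rle0 _ q2) H; case: (M) => // M'.
  by rewrite oppr_le0 sqr_ge0.
elim: M => [|M IH]; first by rewrite !big_ord0 subrr mulr0.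
rewrite !big_ord_recr /= opprD addrACA mulrDr IH /A.
case: M {IH} => [|M]; first by rewrite g0; ring.
by rewrite gS; ring.
Qed.

(* Truncation at order [K] of the expansion of [1 - q x] in powers of the
   Blaschke factor [b = (x - q) / (1 - q x)]; the error term is [(- q b)^K]. *)
Definition sharp (K : nat) : nat -> R :=
  iter K (fun c j => (1 - q ^+ 2) * (j == 0%N)%:R - q * blaschke c j) (fun=> 0).

Definition sharp_error (K m : nat) : R := (m == 0%N)%:R - bin_mean (sharp K) m.

Lemma bin_mean_delta0 m : bin_mean (fun j => (j == 0%N)%:R) m = q ^+ m.
Proof.
by elim: m => [|m IH] //=; rewrite IH bin_mean_cst mulr0 addr0 exprS.
Qed.

Lemma bin_mean_sharpS K m :
  bin_mean (sharp K.+1) m =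
  (1 - q ^+ 2) * q ^+ m - q * bin_mean (blaschke (sharp K)) m.
Proof.
rewrite -(bin_mean_delta0 m) -[- (q * _)]mulNr -bin_meanD.
by apply: eq_bin_mean => j; rewrite mulNr.
Qed.

(** With [b] the Blaschke factor, [1 - (1 - q^2) / (1 - q x) = - q b]; hence one more step of
    [sharp] multiplies the generating function of the error by [- q b]. *)
Lemma sharp_error_rec K :
  sharp_error K.+1 0 = - q * (- q * sharp_error K 0) /\
  forall m, sharp_error K.+1 m.+1 =
    q * sharp_error K.+1 m + (- q * sharp_error K m) -
    q * (- q * sharp_error K m.+1).
Proof.
split=> [|m]; rewrite /sharp_error !bin_mean_sharpS.
  by rewrite bin_mean_blaschke0 eqxx /=; ring.
rewrite bin_mean_blaschkeS (exprS q m).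
have nz k : (k.+1 == 0%N)%:R = 0 :> R by [].
by rewrite nz; ring.
Qed.

Lemma sharp_error_norm K M :
  \sum_(m < M) sharp_error K m ^+ 2 <= (q ^+ K) ^+ 2.
Proof.
elim: K => [|K IH].
  rewrite expr0 expr1n; case: M => [|M]; first by rewrite big_ord0.
  have e m : sharp_error 0 m = (m == 0%N)%:R.
    by rewrite /sharp_error /sharp /= bin_mean_cst subr0.
  rewrite big_ord_recl e expr1n big1 ?addr0 // => i _.
  by rewrite e expr0n.
have [e0 eS] := sharp_error_rec K.
apply: (le_trans (blaschke_norm_le (g := fun m => - q * sharp_error K m) M e0 eS)).
rewrite (eq_bigr (fun m : 'I_M => q ^+ 2 * sharp_error K m ^+ 2)); last first.
  by move=> m _ /=; ring.
rewrite -mulr_sumr (exprS q K) exprMn.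
by apply: ler_wpM2l => //; exact: sqr_ge0.
Qed.

Lemma sharp_error_le K m : `|sharp_error K m| <= q ^+ K.
Proof.
have qK : 0 <= q ^+ K by apply: exprn_ge0; exact: ltW.
rewrite -(@ler_pXn2r _ 2) ?nnegrE //.
apply: (le_trans _ (sharp_error_norm K m.+1)).
rewrite big_ord_recr /= real_normK ?num_real // lerDr.
by apply: sumr_ge0 => i _; exact: sqr_ge0.
Qed.

Lemma sharp_le K j : `|sharp K j| <= 3 ^+ K - 1.
Proof.
elim: K j => [|K IH] j; first by rewrite normr0 expr0 subrr.
rewrite /sharp /= -/(sharp K) (exprS 3 K).
have := IH j; set u := sharp K j => hu.
have : `|if j is j'.+1 then sharp K j' else 0| <= 3 ^+ K - 1.
  case: j {u hu} => [|j]; last exact: IH.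
  by rewrite normr0 subr_ge0 exprn_ege1 // ler1n.
rewrite /blaschke -/u; set v := (if j is _.+1 then _ else _) => hv.
have /andP[q2 q2q] : 0 <= q ^+ 2 <= q.
  by rewrite sqr_ge0 expr2 ger_pMr // ltW.
(* Grouped in this way, the coefficients are at most 1, 2 and 1 in absolute value, and
   [1 + 3 (3^K - 1) <= 3^(K + 1) - 1]. *)
have -> : (1 - q ^+ 2) * (j == 0%N)%:R - q * ((1 + q) * v - q * u) =
   (1 - q ^+ 2) * (j == 0%N)%:R - (q + q ^+ 2) * v + q ^+ 2 * u by ring.
have n1 : `|(1 - q ^+ 2) * (j == 0%N)%:R| <= 1.
  case: (j == 0%N); last by rewrite mulr0 normr0.
  by rewrite mulr1 ger0_norm ?gerBl ?subr_ge0 // (le_trans q2q) // ltW.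
have n2 : `|(q + q ^+ 2) * v| <= 2 * (3 ^+ K - 1).
  rewrite normrM; apply: ler_pM => //.
  rewrite ger0_norm; last by apply: addr_ge0 => //; exact: ltW.
  by apply: lerD; rewrite ?(le_trans q2q) // ltW.
have n3 : `|q ^+ 2 * u| <= 1 * (3 ^+ K - 1).
  rewrite normrM; apply: ler_pM => //.
  by rewrite ger0_norm // (le_trans q2q) // ltW.
apply: (le_trans (ler_normD _ _)).
apply: (le_trans (lerD (ler_normB _ _) (lexx _))).
lra.
Qed.

(** At [x = 0] the Blaschke factor is [- q], so [sharp K] has mean [1 - q^(2 K)] at 0, which is at
    least [1 - q^2]. Dividing by it makes this mean exactly 1 and costs at most a factor
    [1 / (1 - q^2)] elsewhere. *)
Lemma sharp_functional (K : nat) : (0 < K)%N ->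
  exists c : nat -> R,
    [/\ bin_mean c 0 = 1,
        forall m, (0 < m)%N -> `|bin_mean c m| <= q ^+ K / (1 - q ^+ 2) &
        forall j, `|c j| <= 3 ^+ K / (1 - q ^+ 2)].
Proof.
move=> K0.
have q2 : 0 < 1 - q ^+ 2 by rewrite subr_gt0 expr_lt1 // ltW.
pose s := bin_mean (sharp K) 0.
have sE : 1 - q ^+ 2 <= s.
  have h k : sharp_error k 0 = (q ^+ 2) ^+ k.
    elim: k => [|k IH]; first by rewrite /sharp_error /= subr0.
    by have [-> _] := sharp_error_rec k; rewrite IH (exprS _ k); ring.
  have -> : s = 1 - (q ^+ 2) ^+ K by rewrite -h /sharp_error opprB addrC subrK.
  rewrite lerD2l lerN2; case: (K) K0 => // k _; rewrite exprS ger_pMr ?exprn_gt0 //.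
  by rewrite exprn_ile1 ?sqr_ge0 // exprn_ile1 // ltW.
have s0 : 0 < s by exact: lt_le_trans sE.
exists (fun j => s^-1 * sharp K j); split=> [|m m0|j].
- by rewrite bin_meanZ mulVf // gt_eqF.
- rewrite bin_meanZ normrM [leRHS]mulrC gtr0_norm ?invr_gt0 //.
  apply: ler_pM => //; first by rewrite invr_ge0 ltW.
    by rewrite lef_pV2 ?posrE.
  have := sharp_error_le K m; rewrite /sharp_error gtn_eqF // sub0r normrN.
  exact.
- rewrite normrM [leRHS]mulrC gtr0_norm ?invr_gt0 //.
  apply: ler_pM => //; first by rewrite invr_ge0 ltW.
    by rewrite lef_pV2 ?posrE.
  by apply: le_trans (sharp_le K j) _; rewrite gerBl.
Qed.

End BinomialMeans.

(** * Averages of cosines as binomial means *)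

Section TrigonometricAverages.
Variable R : realType.
Implicit Types (L t x theta : R) (h : R -> R).

(** Closure under means is all that products of cosines need, since [cos u * cos v] is the mean of
    [cos (u + v)] and [cos (u - v)]. A bound on weights that holds for every frequency up to [L]
    then passes to the average. *)
Inductive trig_avg L : (R -> R) -> Prop :=
| trig_avg_cos theta h of `|theta| <= L & (forall t, h t = cos (theta * t)) :
    trig_avg L h
| trig_avg_mean h1 h2 h of trig_avg L h1 & trig_avg L h2 &
    (forall t, h t = (h1 t + h2 t) / 2) : trig_avg L h.

Lemma trig_avg_cosM L theta h : trig_avg L h ->
  trig_avg (L + `|theta|) (fun t => cos (theta * t) * h t).
Proof.
elim=> {h} [th h hL hE | h1 h2 h _ IH1 _ IH2 hE].
  apply: (@trig_avg_mean _ (fun t => cos ((th + theta) * t))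
                           (fun t => cos ((th - theta) * t))).
  - apply: (trig_avg_cos (theta := th + theta)) => //.
    by rewrite (le_trans (ler_normD _ _)) // lerD2r.
  - apply: (trig_avg_cos (theta := th - theta)) => //.
    by rewrite (le_trans (ler_normB _ _)) // lerD2r.
  by move=> t; rewrite hE !mulrDl !mulNr cosD cosB; field.
by apply: (trig_avg_mean IH1 IH2) => t; rewrite hE; field.
Qed.

Lemma trig_avg_cosXM L theta h k : trig_avg L h ->
  trig_avg (L + `|theta| * k%:R) (fun t => cos (theta * t) ^+ k * h t).
Proof.
elim: k h => [|k IH] h H.
  rewrite mulr0 addr0 (_ : (fun t => _) = h) //; apply/funext => t.
  by rewrite expr0 mul1r.
have := trig_avg_cosM theta (IH h H).
rewrite (_ : L + _ + _ = L + `|theta| * k.+1%:R); last by rewrite -natr1; ring.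
by congr trig_avg; apply/funext => t; rewrite exprS mulrA.
Qed.

Lemma trig_avg_weaken L L' h : L <= L' -> trig_avg L h -> trig_avg L' h.
Proof.
move=> LL'; elim=> {h} [th h hL hE | h1 h2 h _ IH1 _ IH2 hE].
  by apply: (trig_avg_cos (theta := th)) => //; exact: le_trans LL'.
exact: (trig_avg_mean IH1 IH2).
Qed.

Lemma norm_sin_le x : `|sin x| <= `|x|.
Proof.
wlog x0 : x / 0 < x.
  move=> H; have [x0|x0|<-] := ltgtP 0 x; first exact: H.
    by rewrite -normrN -sinN -[`|x|]normrN; apply: H; rewrite oppr_gt0.
  by rewrite sin0.
have [c _] := @MVT R sin cos 0 x x0 (fun c _ => is_derive_sin c)
   (continuous_subspaceT (@continuous_sin R)).
by rewrite sin0 !subr0 => ->; rewrite normrM ler_piMl // cos_max.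
Qed.

(** Taken at [k x = pi / 2], this bounds [|sin x|] from below by [1 / k]. *)
Lemma norm_sin_natM k x : `|sin (k%:R * x)| <= k%:R * `|sin x|.
Proof.
elim: k => [|k IH]; first by rewrite !mul0r sin0 normr0.
rewrite -natr1 !mulrDl !mul1r sinD (le_trans (ler_normD _ _)) // lerD //.
  by rewrite normrM (le_trans _ IH) // ler_piMr // cos_max.
by rewrite normrM ler_piMl // cos_max.
Qed.

Lemma cos_ge_quadratic x : 1 - cos x <= x ^+ 2 / 2.
Proof.
have -> : cos x = 1 - sin (x / 2) ^+ 2 *+ 2.
  have {1}-> : x = (x / 2) *+ 2 by field.
  by rewrite cos_mulr2n sin2cos2 mulrnBl; ring.
have : sin (x / 2) ^+ 2 <= (x / 2) ^+ 2.
  by rewrite -[leLHS]real_normK ?num_real // -[leRHS]real_normK ?num_real //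
    lerXn2r ?nnegrE // norm_sin_le.
set s := sin _ ^+ 2; rewrite (_ : (x / 2) ^+ 2 = x ^+ 2 / 4); last by field.
by move=> ?; rewrite mulr2n; lra.
Qed.

Variable q : R.
Hypotheses (q0 : 0 < q) (q1 : q < 1).
Local Notation p := (1 - q).

(* The generating sequence is [Re (e^(i phi) x^j)] with
   [x = (e^(i theta) - q) / p], chosen so that [q + p x = e^(i theta)]. *)
Lemma cos_functional theta phi :
  exists c : nat -> R,
    (forall m, bin_mean q c m = cos (phi + theta * m%:R)) /\
    (forall j, `|c j| <= expR (j%:R * (q * theta ^+ 2 / p ^+ 2))).
Proof.
have p0 : p != 0 by rewrite subr_eq0 eq_sym lt_eqF.
pose al := (cos theta - q) / p; pose be := sin theta / p.
pose w := fix w j := if j is j'.+1 then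
  (al * (w j').1 - be * (w j').2, be * (w j').1 + al * (w j').2)
  else (cos phi, sin phi).
pose u j := (w j).1; pose v j := (w j).2.
have U m : bin_mean q u m = cos (phi + theta * m%:R) /\
           bin_mean q v m = sin (phi + theta * m%:R).
  elim: m => [|m [IHu IHv]]; first by rewrite mulr0 addr0.
  rewrite /= (@eq_bin_mean _ q (fun j => u j.+1)
    (fun j => al * u j + (- be) * v j)); last first.
    by move=> j; rewrite /u /v /=; ring.
  rewrite (@eq_bin_mean _ q (fun j => v j.+1)
    (fun j => be * u j + al * v j)) // !bin_meanD IHu IHv.
  rewrite -(natr1 m) (mulrDr theta) mulr1 addrA; set A := phi + _.
  rewrite (sinD A) (cosD A) /al /be.
  by split; field.
exists u; split=> [m|j]; first by have [] := U m.
set y := expR _.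
have y1 : 1 <= y.
  rewrite -[1]addr0; apply: (le_trans _ (expR_ge1Dx _)); rewrite lerD2l.
  by apply: mulr_ge0 => //; apply: divr_ge0; rewrite ?sqr_ge0 // mulr_ge0 ?sqr_ge0 // ltW.
(* Squared modulus of [e^(i phi) x^j]; that of [x] is [(1 - 2 q cos theta + q^2) / p^2]. *)
have H : u j ^+ 2 + v j ^+ 2 = (1 + 2 * q * (1 - cos theta) / p ^+ 2) ^+ j.
  elim: j {y y1} => [|j IH]; first by rewrite /u /v /= cos2Dsin2.
  rewrite (exprS _ j) -IH /u /v /= -/(u j) -/(v j).
  transitivity ((al ^+ 2 + be ^+ 2) * (u j ^+ 2 + v j ^+ 2)); first by ring.
  congr (_ * _).
  by rewrite /al /be !expr_div_n sin2cos2; field.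
have H2 : u j ^+ 2 <= y.
  apply: (@le_trans _ _ (u j ^+ 2 + v j ^+ 2)); first by rewrite lerDl sqr_ge0.
  rewrite H /y expRM_natl; apply: lerXn2r; rewrite ?nnegrE ?expR_ge0 //.
    apply: addr_ge0 => //; apply: divr_ge0; rewrite ?sqr_ge0 //.
    by apply: mulr_ge0; rewrite ?subr_ge0 ?cos_le1 // mulr_ge0 // ltW.
  apply: le_trans (expR_ge1Dx _); rewrite lerD2l.
  rewrite ler_pM2r ?invr_gt0 ?exprn_even_gt0 //.
  rewrite (_ : q * theta ^+ 2 = 2 * q * (theta ^+ 2 / 2)); last by field.
  by rewrite ler_wpM2l ?cos_ge_quadratic // mulr_ge0 // ltW.
(* The bound on the square suffices: a number above 1 in absolute value is at most its own square
   there. *)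
have [u1|u1] := leP `|u j| 1; first exact: le_trans y1.
apply: le_trans H2; rewrite -[leRHS]real_normK ?num_real // expr2.
by rewrite ler_peMl // ltW.
Qed.

Lemma trig_avg_functional L h (a : R) : trig_avg L h ->
  exists c : nat -> R,
    (forall m, bin_mean q c m = h (m%:R - a)) /\
    (forall j, `|c j| <= expR (j%:R * (q * L ^+ 2 / p ^+ 2))).
Proof.
elim=> {h} [th h hL hE | h1 h2 h _ [c1 [H1 B1]] _ [c2 [H2 B2]] hE].
  have [c [Hc Bc]] := cos_functional th (- th * a).
  exists c; split=> [m|j]; first by rewrite Hc hE mulrBr addrC mulNr.
  apply: le_trans (Bc j) _; rewrite ler_expR ler_wpM2l //.
  rewrite ler_wpM2r ?invr_ge0 ?sqr_ge0 //.
  apply: ler_wpM2l; first exact: ltW.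
  rewrite -[leLHS]real_normK ?num_real // lerXn2r ?nnegrE //.
  exact: le_trans hL.
exists (fun j => 2^-1 * c1 j + 2^-1 * c2 j); split=> [m|j].
  by rewrite bin_meanD H1 H2 hE; field.
rewrite (le_trans (ler_normD _ _)) // !normrM ger0_norm ?invr_ge0 //.
have := B1 j; have := B2 j; lra.
Qed.

End TrigonometricAverages.

(** * A bump made of cosines at dyadic scales *)

Section Bump.
Variable R : realType.
Implicit Types (x t : R).

(** With this normalization [freq z s * |t|] lies between [pi / 4] and [pi / 2] when [|t|] lies
    between [2^s z] and [2^(s+1) z]. *)
Definition freq (z s : nat) : R := pi / (4 * z * 2 ^ s)%:R.

(* The factor [s] is at most [2 ^- r] when [2 ^ s z < |t| <= 2 ^ s.+1 z]; the
   factor [s = 0] is at most [1 - (2 z) ^- 2] when [0 < |t| <= z]. *)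
Definition bump (z r n : nat) (t : R) : R :=
  \prod_(s < n) cos (freq z s * t) ^+ (2 * r).

Lemma freq_gt0 z s : (0 < z)%N -> 0 < freq z s.
Proof.
by move=> z0; rewrite divr_gt0 ?pi_gt0 // ltr0n !muln_gt0 z0 expn_gt0.
Qed.

(** The frequencies form a geometric series with sum below [pi / (2 z)], and each cosine is raised
    to the power [2 r]; the bound is therefore free of the number of factors. *)
Lemma trig_avg_bump z r n : (0 < z)%N ->
  trig_avg (pi * r%:R / z%:R) (bump z r n).
Proof.
move=> z0; have zn0 : z%:R != 0 :> R by rewrite pnatr_eq0 -lt0n.
have H : trig_avg (\sum_(s < n) `|freq z s| * (2 * r)%:R) (bump z r n).
  elim: n => [|n IH].
    rewrite big_ord0; apply: (trig_avg_cos (theta := 0)).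
      by rewrite normr0.
    by move=> t; rewrite /bump big_ord0 mul0r cos0.
  rewrite big_ord_recr /=.
  have := trig_avg_cosXM (freq z n) (2 * r) IH.
  by congr trig_avg; apply/funext => t; rewrite /bump big_ord_recr /= mulrC.
apply: trig_avg_weaken H.
rewrite -mulr_suml.
have -> : \sum_(s < n) `|freq z s| = pi / (2 * z%:R) * (1 - 2 ^- n).
  elim: n => [|n IH]; first by rewrite big_ord0 expr0 invr1 subrr mulr0.
  rewrite big_ord_recr /= IH gtr0_norm ?freq_gt0 // /freq !natrM natrX exprS.
  have : 2 ^+ n != 0 :> R by rewrite expf_neq0 // pnatr_eq0.
  by move=> n0; field; rewrite n0 zn0.
rewrite natrM [leLHS](_ : _ = pi * r%:R / z%:R * (1 - 2 ^- n)); last by set e := 2 ^- n; field.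
rewrite ler_piMr ?gerBl ?invr_ge0 ?exprn_ge0 //.
by rewrite !mulr_ge0 ?invr_ge0 ?pi_ge0.
Qed.

Lemma cosX_even_itv x r : 0 <= cos x ^+ (2 * r) <= 1.
Proof.
rewrite exprM; apply/andP; split; first by rewrite exprn_ge0 ?sqr_ge0.
by rewrite exprn_ile1 ?sqr_ge0 // cos2sin2 gerBl sqr_ge0.
Qed.

Lemma bump_itv z r n t : 0 <= bump z r n t <= 1.
Proof.
apply/andP; split; first by apply: prodr_ge0 => s _; have /andP[] := cosX_even_itv (freq z s * t) r.
by apply: prodr_ile1 => s _; exact: cosX_even_itv.
Qed.

Lemma bump_le_factor z r n (s : 'I_n) t :
  bump z r n t <= cos (freq z s * t) ^+ (2 * r).
Proof.
rewrite /bump (bigD1 s) //= ler_piMr //.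
  by have /andP[] := cosX_even_itv (freq z s * t) r.
by apply: prodr_ile1 => i _; exact: cosX_even_itv.
Qed.

(** The factor at scale [s] suffices: twice its angle lies in [[pi / 2, pi]], where the cosine is
    nonpositive, so its squared cosine is at most 1/2. *)
Lemma bump_far z r n s t : (0 < z)%N -> (s < n)%N ->
  (2 ^ s * z)%:R <= `|t| <= (2 ^ s.+1 * z)%:R -> bump z r n t <= 2 ^- r.
Proof.
move=> z0 sn /andP[t1 t2].
apply: (le_trans (bump_le_factor z r (Ordinal sn) t)); rewrite /=.
rewrite -cos_norm normrM gtr0_norm ?freq_gt0 // exprM -exprVn.
apply: lerXn2r; rewrite ?nnegrE ?sqr_ge0 ?invr_ge0 //.
set x := freq z s * `|t|.
have z0R : 0 < z%:R :> R by rewrite ltr0n.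
have s0R : 0 < 2 ^+ s :> R by rewrite exprn_gt0.
have x1 : pi / 2 <= x *+ 2.
  rewrite /x /freq -(mulr_natr (_ * _)) !natrM natrX.
  have := pi_gt0 R => pi0.
  rewrite (_ : pi / 2 = pi / (4 * z%:R * 2 ^+ s) * (2 ^+ s * z%:R) * 2); last first.
    by field; rewrite !gt_eqF.
  rewrite ler_pM2r // ler_pM2l ?divr_gt0 ?mulr_gt0 //.
  by move: t1; rewrite natrM natrX.
have x2 : x *+ 2 <= pi.
  rewrite /x /freq -(mulr_natr (_ * _)) !natrM natrX.
  have := pi_gt0 R => pi0.
  rewrite [leRHS](_ : _ = pi / (4 * z%:R * 2 ^+ s) * (2 ^+ s.+1 * z%:R) * 2); last first.
    by rewrite (exprS _ s); field; rewrite !gt_eqF.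
  rewrite ler_pM2r // ler_pM2l ?divr_gt0 ?mulr_gt0 //.
  by move: t2; rewrite natrM natrX.
have : cos (x *+ 2) <= cos (pi / 2).
  rewrite leNgt ltr_cos -?leNgt // in_itv /=.
    by rewrite x2 (le_trans _ x1) // divr_ge0 ?pi_ge0.
  by rewrite divr_ge0 ?pi_ge0 //= ler_piMr ?pi_ge0 // invf_le1 // ler1n.
rewrite cos_pihalf cos_mulr2n mulr2n; lra.
Qed.

(** The factor at scale 0 suffices: its angle is between [freq z 0] and [pi / 4], so its squared
    cosine is at most [1 - sin (pi / (4 z))^2], and [norm_sin_natM] bounds this sine below by
    [1 / (2 z)]. *)
Lemma bump_near z r n t : (0 < z)%N -> (0 < n)%N -> (0 < r)%N ->
  1 <= `|t| <= z%:R -> bump z r n t <= 1 - (4 * z%:R ^+ 2)^-1.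
Proof.
move=> z0 n0 r0 /andP[t1 t2].
apply: (le_trans (bump_le_factor z r (Ordinal n0) t)); rewrite /=.
rewrite -cos_norm normrM gtr0_norm ?freq_gt0 // exprM.
have z0R : 0 < z%:R :> R by rewrite ltr0n.
have pi0 := pi_gt0 R.
have f0 := freq_gt0 0 z0.
have fE : freq z 0 = pi / (4 * z%:R) by rewrite /freq muln1 natrM.
have c0 x : 0 <= x <= pi / 2 -> 0 <= cos x.
  move=> /andP[x0 x1]; apply: cos_ge0_pihalf; rewrite x1 andbT.
  by rewrite (le_trans _ x0) // oppr_le0 divr_ge0 // ltW.
have ft : freq z 0 * `|t| <= pi / 4.
  rewrite (_ : pi / 4 = freq z 0 * z%:R); first by rewrite ler_pM2l.
  by rewrite fE; field; rewrite gt_eqF.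
have f1 : freq z 0 <= freq z 0 * `|t| by rewrite ler_peMr // ltW.
have step1 : cos (freq z 0 * `|t|) <= cos (freq z 0).
  rewrite leNgt ltr_cos -?leNgt // in_itv /=; apply/andP; split; lra.
apply: (@le_trans _ _ (cos (freq z 0) ^+ 2)).
  apply: (@le_trans _ _ ((cos (freq z 0 * `|t|)) ^+ 2)).
    case: (r) r0 => // r' _; rewrite (exprS _ r') ler_piMr ?sqr_ge0 //.
    by rewrite exprn_ile1 ?sqr_ge0 // cos2sin2 gerBl sqr_ge0.
  apply: lerXn2r; rewrite ?nnegrE //; apply: c0.
    by rewrite mulr_ge0 ?(ltW f0) //=; lra.
  by rewrite (ltW f0) /=; lra.
rewrite cos2sin2 lerD2l lerN2.
have := norm_sin_natM (2 * z) (freq z 0).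
rewrite fE natrM (_ : 2 * z%:R * (pi / (4 * z%:R)) = pi / 2); last first.
  by field; rewrite gt_eqF.
rewrite sin_pihalf normr1; set s := sin _ => H.
have -> : (4 * z%:R ^+ 2)^-1 = ((2 * z%:R)^-1) ^+ 2 :> R.
  by field; rewrite gt_eqF.
rewrite -[leRHS]real_normK ?num_real //; apply: lerXn2r; rewrite ?nnegrE ?invr_ge0 ?mulr_ge0 //.
by rewrite -[(_)^-1]mulr1 ler_pdivrMl // mulr_gt0.
Qed.

(** Since [s < 2 ^ s], the scales below [n] cover all distances up to [n], so [n] factors are enough
    in [bump]. *)
Lemma dyadic_scale (z t n : nat) : (0 < z)%N -> (z < t)%N -> (t <= n)%N ->
  exists2 s, (s < n)%N & (2 ^ s * z <= t <= 2 ^ s.+1 * z)%N.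
Proof.
move=> z0 zt tn.
have ex : exists s, (2 ^ s * z <= t)%N by exists 0; rewrite mul1n ltnW.
have lt2 s : (s < 2 ^ s)%N by exact: ltn_expl.
have ub s : (2 ^ s * z <= t)%N -> (s <= n)%N.
  move=> h; apply: (leq_trans (ltnW (lt2 s))); apply: leq_trans tn.
  by apply: leq_trans h; rewrite leq_pmulr.
exists (ex_maxn ex ub); case: ex_maxnP => s h m.
  by apply: leq_trans tn; apply: leq_trans h; apply: (leq_trans (lt2 s)); rewrite leq_pmulr.
rewrite h /= ltnW // ltnNge; apply/negP => /m; by rewrite ltnn.
Qed.

Variable q : R.
Hypotheses (q0 : 0 < q) (q1 : q < 1).

Lemma bump_functional (z r n a : nat) : (0 < z)%N -> (0 < r)%N -> (a <= n)%N ->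
  exists c : nat -> R,
  [/\ bin_mean q c a = 1,
      forall m, 0 <= bin_mean q c m <= 1,
      forall m, (m <= n)%N -> m != a ->
        bin_mean q c m <= 1 - (4 * z%:R ^+ 2)^-1,
      forall m, (m <= n)%N -> (z < `|m - a|)%N -> bin_mean q c m <= 2 ^- r &
      forall j, `|c j| <=
        expR (j%:R * (q * (pi * r%:R / z%:R) ^+ 2 / (1 - q) ^+ 2))].
Proof.
move=> z0 r0 an.
have [c [Hc Bc]] := trig_avg_functional q0 q1 a%:R (trig_avg_bump r n z0).
have dE m : `|m%:R - a%:R : R| = `|m - a|%N%:R.
  by rewrite natr_absz intr_norm rmorphB.
have far m : (m <= n)%N -> (z < `|m - a|)%N -> bin_mean q c m <= 2 ^- r.
  move=> mn zt; have tn : (`|m - a| <= n)%N by lia.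
  have [s sn st] := dyadic_scale z0 zt tn.
  by rewrite Hc; apply: (bump_far r z0 sn); rewrite dE !ler_nat.
exists c; split=> //.
- rewrite Hc subrr /bump big1 // => s _.
  by rewrite mulr0 cos0 expr1n.
- by move=> m; rewrite Hc bump_itv.
move=> m mn ma; have [zt|zt] := ltnP z `|m - a|.
  apply: (le_trans (far _ mn zt)).
  apply: (@le_trans _ _ 2^-1).
    rewrite lef_pV2 ?posrE ?exprn_gt0 //.
    by case: (r) r0 => // r' _; rewrite exprS ler_peMr // exprn_ege1 // ler1n.
  have : (4 * z%:R ^+ 2)^-1 <= 4^-1 :> R.
    rewrite lef_pV2 ?posrE ?mulr_gt0 ?exprn_gt0 ?ltr0n //.
    by rewrite ler_peMr // exprn_ege1 // ler1n.
  lra.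
rewrite Hc bump_near //; first by lia.
by rewrite dE ler_nat ler1n zt andbT; lia.
Qed.

End Bump.

(** * Random surviving sets and independence across dimensions *)

Section RandomSubsets.
Variables (R : realType) (q : R).
Local Notation p := (1 - q).
Local Notation disj A B := (fintype.disjoint (mem A) (mem B)).

Definition survival_prob (T : finType) (S : {set T}) : R :=
  \prod_(x : T) (if x \in S then p else q).

(** Resampling the fate of [x] alone: sets are paired as [S] and [x |: S], whose probabilities are
    in the ratio [q] to [p]. *)
Lemma survival_prob_condition (T : finType) (x : T) (F : {set T} -> R) :
  \sum_S survival_prob S * F S =
  \sum_S survival_prob S * (q * F (S :\ x)%SET + p * F (x |: S)%SET).
Proof.
have split_sum (G : {set T} -> R) :
    \sum_S G S = \sum_(S : {set T} | x \notin S) (G S + G (x |: S)%SET).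
  rewrite big_split /= (bigID (fun S : {set T} => x \notin S)) /=; congr (_ + _).
  rewrite (reindex_onto (fun S => x |: S)%SET (fun S => S :\ x)%SET) /=.
    apply: eq_bigl => S; rewrite finset.setU11 /=.
    apply/idP/idP => [/eqP <-|xS]; first by rewrite setD11.
    by rewrite setU1K.
  by move=> S; rewrite negbK => xS; rewrite finset.setD1K.
rewrite split_sum [RHS]split_sum; apply: eq_bigr => S xS.
have -> : (S :\ x = S)%SET.
  by apply/setP => y; rewrite in_setD1; case: eqP => // ->; rewrite (negbTE xS).
have -> : ((x |: S) :\ x = S)%SET by rewrite setU1K.
have -> : (x |: (x |: S) = x |: S)%SET by rewrite finset.setUA finset.setUid.
pose w := \prod_(y | y != x) (if y \in S then p else q).
have -> : survival_prob S = q * w.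
  by rewrite /survival_prob (bigD1 x) //= (negbTE xS).
have -> : survival_prob (x |: S)%SET = p * w.
  rewrite /survival_prob (bigD1 x) //= finset.setU11; congr (_ * _).
  by apply: eq_bigr => y yx; rewrite in_setU1 (negbTE yx).
ring.
Qed.

(** Conditioning on the elements of [A] one by one reproduces the recursion of [bin_mean], while
    [g], which does not depend on them, factors out. *)
Lemma survival_card_mean (T : finType) (A : {set T}) (c : nat -> R)
    (g : {set T} -> R) :
  (forall S x, x \in A -> g (x |: S)%SET = g (S :\ x)%SET) ->
  \sum_S survival_prob S * (c #|S :&: A|%SET * g S) =
  bin_mean q c #|A| * \sum_S survival_prob S * g S.
Proof.
elim: {A}_.+1 {-2}A (ltnSn #|A|) c => // k IH A Ak c gA.
have [->|[x xA]] := set_0Vmem A.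
  rewrite cards0 /= mulr_sumr; apply: eq_bigr => S _.
  by rewrite finset.setI0 cards0; ring.
have cA : #|A| = #|A :\ x|%SET.+1 by rewrite (cardsD1 x) xA.
rewrite (survival_prob_condition x) cA /=.
have gx S : g (S :\ x)%SET = g S /\ g (x |: S)%SET = g S.
  have [xS|xS] := boolP (x \in S).
    by rewrite -gA //; have -> : (x |: S = S)%SET
      by apply/finset.setUidPr; rewrite finset.sub1set.
  rewrite gA //; suff -> : (S :\ x = S)%SET by [].
  by apply/setP => y; rewrite in_setD1; case: eqP => // ->; rewrite (negbTE xS).
have c1 S : #|(S :\ x) :&: A|%SET = #|S :&: (A :\ x)|%SET.
  by apply: eq_card => y; rewrite !inE; case: eqP; rewrite ?andbF.
have c2 S : #|(x |: S) :&: A|%SET = #|S :&: (A :\ x)|%SET.+1.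
  rewrite (cardsD1 x) !inE eqxx xA /= add1n; congr _.+1.
  by apply: eq_card => y; rewrite !inE; case: eqP => //= _; rewrite andbF.
under eq_bigr => S _.
  rewrite c1 c2 (gx S).1 (gx S).2.
  rewrite (_ : _ * _ = q * (survival_prob S * (c #|S :&: (A :\ x)|%SET * g S)) +
     p * (survival_prob S * (c #|S :&: (A :\ x)|%SET.+1 * g S))); last by ring.
  over.
rewrite big_split /= -!mulr_sumr (IH (A :\ x)%SET) ?(IH (A :\ x)%SET _ (fun j => c j.+1)).
- by ring.
- by rewrite cA in Ak.
- by move=> S y; rewrite in_setD1 => /andP[_ yA]; exact: gA.
- by rewrite cA in Ak.
- by move=> S y; rewrite in_setD1 => /andP[_ yA]; exact: gA.
Qed.

Lemma survival_subset_prob (T : finType) (K : {set T}) :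
  \sum_(S : {set T}) survival_prob S * (K \subset S)%:R = p ^+ #|K|.
Proof.
rewrite -prodr_const [in RHS]big_mkcond /=.
transitivity (\prod_(x : T) \sum_(b : bool)
    (if b then p else q) * ((x \in K) ==> b)%:R); last first.
  apply: eq_bigr => x _; rewrite big_bool /=.
  by case: (x \in K); rewrite ?mulr1 ?mulr0 ?addr0 // subrK.
rewrite bigA_distr_bigA /=.
rewrite (reindex_onto (fun S : {set T} => [ffun x => x \in S])
   (fun f : {ffun T -> bool} => [set x | f x]%SET)) /=; last first.
  by move=> f _; apply/ffunP => x; rewrite ffunE inE.
apply: eq_big => [S|S _].
  by apply/esym/eqP/setP => x; rewrite inE ffunE.
rewrite big_split /=; congr (_ * _).
  by apply: eq_bigr => x _; rewrite ffunE.
have [sKS|/subsetPn[x xK xS]] := boolP (K \subset S).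
  rewrite big1 // => x _; rewrite ffunE.
  by case: (boolP (x \in K)) => // /(fintype.subsetP sKS) ->.
by rewrite (bigD1 x) //= ffunE xK (negbTE xS) mul0r.
Qed.

Lemma survival_window_mean (T : finType) (K A0 A1 A2 : {set T})
    (c0 c1 c2 : nat -> R) :
  disj A0 A1 -> disj A0 A2 -> disj A1 A2 ->
  disj A0 K -> disj A1 K -> disj A2 K ->
  \sum_(S : {set T}) survival_prob S * (c0 #|S :&: A0|%SET *
     (c1 #|S :&: A1|%SET * (c2 #|S :&: A2|%SET * (K \subset S)%:R))) =
  bin_mean q c0 #|A0| * (bin_mean q c1 #|A1| * (bin_mean q c2 #|A2| * p ^+ #|K|)).
Proof.
move=> d01 d02 d12 d0 d1 d2.
have inv (A B : {set T}) S x : disj A B -> x \in A ->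
    ((x |: S) :&: B = (S :\ x) :&: B)%SET.
  move=> dAB xA; apply/setP => y; rewrite !inE; case: eqP => //= ->.
  by rewrite (disjointFr dAB xA).
have invK (A : {set T}) S x : disj A K -> x \in A ->
    (K \subset x |: S) = (K \subset S :\ x).
  move=> dAB xA; rewrite !(sameP finset.setIidPr eqP).
  by rewrite [X in X == _](inv A).
rewrite survival_card_mean; last first.
  by move=> S x xA; rewrite (inv A0 A1) // (inv A0 A2) // (invK A0).
rewrite survival_card_mean; last first.
  by move=> S x xA; rewrite (inv A1 A2) // (invK A1).
rewrite survival_card_mean ?survival_subset_prob //.
by move=> S x xA; rewrite (invK A2).
Qed.

(** A set of deleted slices amounts to one set of survivors per dimension, and these are
    independent. *)
Lemma deletion_prob_prod (n d : nat) (F : 'I_d -> {set 'I_n} -> R) :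
  \sum_(D : {set 'I_d * 'I_n}) deletion_prob q D * \prod_i F i (survivors D i) =
  \prod_i \sum_(S : {set 'I_n}) survival_prob S * F i S.
Proof.
rewrite bigA_distr_bigA /=.
pose h (D : {set 'I_d * 'I_n}) := [ffun i => survivors D i].
pose h' (f : {ffun 'I_d -> {set 'I_n}}) := [set u | u.2 \notin f u.1]%SET.
rewrite (reindex_onto h h') /=; last first.
  by move=> f _; apply/ffunP => i; apply/setP => a; rewrite !ffunE !inE negbK.
apply: eq_big => [D|D _].
  by apply/esym/eqP/setP => -[i a]; rewrite !inE /= ffunE inE negbK.
rewrite big_split /=; congr (_ * _); last by apply: eq_bigr => i _; rewrite ffunE.
rewrite /deletion_prob /survival_prob pair_big /=.
apply: eq_bigr => -[i a] _ /=.
by rewrite ffunE inE; case: (_ \in D).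
Qed.

End RandomSubsets.

(** * Order-preserving relabelling of surviving indices *)

Section Ranks.
Variable n : nat.
Implicit Types (S : {set 'I_n}) (x y : 'I_n).

Lemma sorted_index_count (T : eqType) (r : rel T) (s : seq T) (x : T) :
  irreflexive r -> antisymmetric r -> transitive r -> sorted r s -> x \in s ->
  index x s = count (r^~ x) s.
Proof.
move=> r_irr r_anti r_tr; elim: s => //= y s IH rs; rewrite in_cons.
have ys := order_path_min r_tr rs.
have [->|xy] /= := eqVneq x y; last first.
  by move=> xs; rewrite (IH (path_sorted rs) xs) (allP ys _ xs) add1n.
move=> _; rewrite r_irr add0n; apply/esym/eqP; rewrite -leqn0 leqNgt -has_count.
apply/hasPn => z zs; apply/negP => rzy.
have ryz := allP ys _ zs.
by have := r_irr y; rewrite (r_tr _ _ _ ryz rzy).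
Qed.

Lemma enum_set_sorted S : sorted (fun x y => (x < y)%N) (enum S).
Proof.
rewrite /enum_mem; apply: (sorted_filter (leT := fun x y : 'I_n => (x < y)%N)).
  by move=> x y z; exact: ltn_trans.
by rewrite -enumT -(@sorted_map _ _ (val : 'I_n -> nat) ltn) val_enum_ord iota_ltn_sorted.
Qed.

Lemma index_enum_set S x : x \in S ->
  index x (enum S) = #|S :&: [set y : 'I_n | (y < x)%N]|%SET.
Proof.
move=> xS; rewrite (sorted_index_count (r := fun x y : 'I_n => (x < y)%N)) //.
- rewrite -size_filter -(card_uniqP (filter_uniq _ (enum_uniq _))).
  by apply: eq_card => y; rewrite !inE mem_filter mem_enum andbC.
- by move=> y; rewrite ltnn.
- by move=> y z /andP[yz zy]; have := ltn_trans yz zy; rewrite ltnn.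
- by move=> x' y z; exact: ltn_trans.
- exact: enum_set_sorted.
- by rewrite mem_enum.
Qed.

Lemma index_enum_setT x : index x (enum [set: 'I_n]%SET) = x.
Proof.
rewrite (_ : enum _ = enum 'I_n) ?index_enum_ord //.
by apply: eq_enum => y; rewrite !inE.
Qed.

(** [rank] takes an index of the original to its label in the trace and [unrank] goes back. Both
    stay in ['I_n], with [x] itself as default, and are inverse to each other between [S] and the
    labels below [#|S|]. *)
Definition rank S x : 'I_n := insubd x (index x (enum S)).
Definition unrank S x : 'I_n := nth x (enum S) x.

Lemma rank_val S x : x \in S -> rank S x = index x (enum S) :> nat.
Proof.
move=> xS; rewrite /rank val_insubd ifT //.
apply: (@leq_trans #|S|); first by rewrite cardE index_mem mem_enum.
by rewrite -[leqRHS](card_ord n) max_card.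
Qed.

Lemma rank_lt S x : x \in S -> (rank S x < #|S|)%N.
Proof. by move=> xS; rewrite rank_val // cardE index_mem mem_enum. Qed.

Lemma rankK S x : x \in S -> unrank S (rank S x) = x.
Proof. by move=> xS; rewrite /unrank rank_val // nth_index // mem_enum. Qed.

Lemma unrank_in S x : (x < #|S|)%N -> unrank S x \in S.
Proof. by move=> xS; rewrite -mem_enum mem_nth // -cardE. Qed.

Lemma unrankK S x : (x < #|S|)%N -> rank S (unrank S x) = x.
Proof.
move=> xS; apply: val_inj; rewrite /= rank_val ?unrank_in //.
by rewrite index_uniq ?enum_uniq // -cardE.
Qed.

Lemma rank_mono S x y : x \in S -> y \in S -> (rank S x < rank S y)%N = (x < y)%N.
Proof.
move=> xS yS.
have lt u v : u \in S -> v \in S -> (u < v)%N -> (rank S u < rank S v)%N.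
  move=> uS vS uv; rewrite !rank_val // !index_enum_set //.
  apply: proper_card; apply/properP; split.
    apply/fintype.subsetP => z; rewrite !inE => /andP[-> zu].
    exact: ltn_trans uv.
  by exists u; rewrite !inE ?uS ?uv // ltnn andbF.
case: (ltngtP x y) => [xy|yx|/val_inj ->]; [exact: lt| |exact: ltnn].
by apply/negbTE; rewrite -leqNgt ltnW // lt.
Qed.

Definition increasing W (K : {ffun 'I_W.+1 -> 'I_n}) : bool :=
  [forall s : 'I_W.+1, forall t : 'I_W.+1, (s < t)%N ==> (K s < K t)%N].

Lemma increasingP W (K : {ffun 'I_W.+1 -> 'I_n}) :
  reflect (forall s t : 'I_W.+1, (s < t)%N -> (K s < K t)%N) (increasing K).
Proof.
apply: (iffP forallP) => [H s t|H s]; first exact: (implyP (forallP (H s) t)).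
by apply/forallP => t; apply/implyP; exact: H.
Qed.

Lemma increasing_le W (K : {ffun 'I_W.+1 -> 'I_n}) (s t : 'I_W.+1) :
  increasing K -> (s <= t)%N -> (K s <= K t)%N.
Proof.
move=> /increasingP K_incr; rewrite leq_eqVlt => /orP[/eqP/val_inj -> //|st].
by rewrite ltnW // K_incr.
Qed.

Lemma increasing_inj W (K : {ffun 'I_W.+1 -> 'I_n}) :
  increasing K -> injective (K : 'I_W.+1 -> 'I_n).
Proof.
move=> /increasingP K_incr s t Kst; apply: val_inj => /=.
by case: (ltngtP s t) => // /K_incr; rewrite Kst ltnn.
Qed.

Definition gaps W (K : {ffun 'I_W.+1 -> 'I_n}) : {set 'I_n} :=
  [set y : 'I_n | [&& (K ord0 < y)%N, (y < K ord_max)%N & y \notin codom K]]%SET.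

(** This lemma and the next two rewrite the arguments of the three weights of a window in the trace
    as numbers of survivors in sets of original slices: before, after and inside the window. *)
Lemma rank_below S x : x \in S ->
  rank S x = #|S :&: [set y : 'I_n | (y < x)%N]|%SET :> nat.
Proof. by move=> xS; rewrite rank_val // index_enum_set. Qed.

Lemma rank_above S x : x \in S ->
  (#|S|.-1 - rank S x)%N = #|S :&: [set y : 'I_n | (x < y)%N]|%SET.
Proof.
move=> xS; rewrite rank_below //.
have : #|S| = (#|S :&: [set y : 'I_n | (y < x)%N]| + 1 +
  #|S :&: [set y : 'I_n | (x < y)%N]|)%SET%N.
  rewrite -(cards1 x) -!sum1_card !(big_mkcond (fun y => y \in _)) /=.
  rewrite -!big_split /=; apply: eq_bigr => y _; rewrite !inE.
  rewrite -val_eqE /=; case: (boolP (y \in S)) => /= [_|yS]; first by case: ltngtP.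
  by case: eqP => // /val_inj yx; rewrite yx xS in yS.
move=> ->; lia.
Qed.

Lemma rank_gaps W S (K : {ffun 'I_W.+1 -> 'I_n}) :
  increasing K -> (forall s, K s \in S) ->
  (rank S (K ord_max) - rank S (K ord0) - W)%N = #|S :&: gaps K|%SET.
Proof.
move=> K_incr KS; rewrite !rank_below //.
have : #|[set K s | s : 'I_W.+1] :\ K ord_max|%SET = W.
  apply/eqP; rewrite -eqSS -[X in _ == X.+1]/W; apply/eqP.
  rewrite -add1n -[in RHS](card_ord W.+1) -(card_imset _ (increasing_inj K_incr)).
  rewrite [RHS](cardsD1 (K ord_max)); congr (_ + _)%N.
  by rewrite (_ : _ \in _) //; apply/imsetP; exists ord_max.
(* A survivor below the last index of the window is below its first index, on the window, or in a
   gap; the window has [W] indices other than the last. *)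
have : (#|S :&: [set y : 'I_n | (y < K ord_max)%N]| =
   #|S :&: [set y : 'I_n | (y < K ord0)%N]| +
   #|[set K s | s : 'I_W.+1] :\ K ord_max| + #|S :&: gaps K|)%SET%N.
  rewrite -!sum1_card !(big_mkcond (fun y => y \in _)) /=.
  rewrite -!big_split /=; apply: eq_bigr => y _; rewrite !inE.
  have [/codomP[s ->]|yK] := boolP (y \in codom K).
    rewrite KS imset_f //= andbT !andbF.
    rewrite (inj_eq (increasing_inj K_incr)).
    have -> : (K s < K ord0)%N = false.
      by apply/negbTE; rewrite -leqNgt increasing_le.
    have [->|sm] := eqVneq s ord_max; first by rewrite ltnn.
    have sW : (s < W)%N by rewrite ltn_neqAle -ltnS ltn_ord andbT; exact: sm.
    by rewrite (increasingP _ K_incr).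
  have -> : (y \in [set K s | s : 'I_W.+1]%SET) = false.
    apply/negbTE; apply: contra yK => /imsetP[s _ ->]; exact: codom_f.
  have K0 := increasing_le (s := ord0) (t := ord_max) K_incr (leq0n _).
  have : y != K ord0 :> nat.
    by rewrite val_eqE; apply: contra yK => /eqP ->; exact: codom_f.
  rewrite andbF andbT; case: (y \in S) => //=.
  by case: (ltngtP y (K ord0)) => //= yK0 _; rewrite ?(leq_trans yK0) //; case: ifP.
by move=> -> ->; rewrite -addnA !addKn.
Qed.

Lemma rank_setT x : rank [set: 'I_n]%SET x = x.
Proof. by apply: val_inj; rewrite /= rank_val ?inE // index_enum_setT. Qed.

Lemma card_below x : #|[set y : 'I_n | (y < x)%N]%SET| = x.
Proof.
by rewrite -[RHS](f_equal val (rank_setT x)) /= rank_below ?inE // finset.setTI.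
Qed.

Lemma card_above x : #|[set y : 'I_n | (x < y)%N]%SET| = (n.-1 - x)%N.
Proof.
have := @rank_above [set: 'I_n]%SET x; rewrite inE => /(_ isT).
by rewrite rank_setT finset.setTI cardsT card_ord.
Qed.

Lemma card_gaps W (K : {ffun 'I_W.+1 -> 'I_n}) : increasing K ->
  #|gaps K| = (K ord_max - K ord0 - W)%N.
Proof.
move=> K_incr; have := @rank_gaps W [set: 'I_n]%SET K K_incr.
rewrite !rank_setT finset.setTI => -> // s.
by rewrite inE.
Qed.

End Ranks.

(** * The window statistic and its mean *)

Section Statistic.
Variables (R : realType) (n d W : nat).
Local Notation window := {ffun 'I_W.+1 -> 'I_n}.
Local Notation offset := {ffun 'I_d -> 'I_W.+1}.

(** Lookup by natural numbers avoids indices whose type depends on the side lengths of the trace;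
    outside the trace the value is [false]. *)
Definition entry (U : sized_hypermatrix d) (k : 'I_d -> nat) : bool :=
  [exists g : {dffun forall i : 'I_d, 'I_(projT1 U i)},
    [forall i, val (g i) == k i] && projT2 U g].

Lemma entry_trace (X : cube n d) (D : {set 'I_d * 'I_n}) (k : 'I_d -> 'I_n) :
  (forall i, k i \in survivors D i) ->
  entry (trace X D) (fun i => rank (survivors D i) (k i)) = X [ffun i => k i].
Proof.
move=> kS; apply/existsP/idP => [[g /andP[/forallP gk]]|Xk] /=.
  rewrite ffunE; congr (is_true (X _)); apply/ffunP => i; rewrite !ffunE.
  rewrite (enum_val_nth (k i)) (eqP (gk i)) rank_val //.
  by rewrite nth_index // mem_enum.
pose g : {dffun forall i : 'I_d, 'I_#|survivors D i|} :=
  [ffun i => Ordinal (rank_lt (kS i))].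
exists g; apply/andP; split; first by apply/forallP => i; rewrite ffunE.
rewrite /= ffunE; move: Xk; congr (is_true (X _)); apply/ffunP => i.
rewrite !ffunE (enum_val_nth (k i)) /= rank_val //.
by rewrite nth_index // mem_enum.
Qed.

Variables (pat : pred offset) (w : offset -> bool) (c0 c1 c2 : 'I_d -> nat -> R).

(** Tuples are taken in ['I_n], large enough for every trace, so that all traces share one finite
    range of summation; the condition on [projT1 U] keeps the tuples that fit. *)
Definition statistic (U : sized_hypermatrix d) : R :=
  \sum_(J : {ffun 'I_d -> window} |
      [forall i, increasing (J i)] && [forall i, forall s : 'I_W.+1, (J i s < projT1 U i)%N])
    [forall s, pat s ==> (entry U (fun i => J i (s i)) == w s)]%:R *
    \prod_i (c0 i (J i ord0) *
             (c1 i (J i ord_max - J i ord0 - W)%N *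
              c2 i ((projT1 U i).-1 - J i ord_max)%N)).

Definition matches (X : cube n d) (K : {ffun 'I_d -> window}) : bool :=
  [forall s, pat s ==> (X [ffun i => K i (s i)] == w s)].

(** Tuples of trace indices correspond through [rank] and [unrank] to tuples of surviving slices.
    The indicator in the last factor lets the sum run over all increasing tuples, a range
    independent of [D], so that the mean can be taken termwise. *)
Lemma statistic_trace (X : cube n d) (D : {set 'I_d * 'I_n}) :
  statistic (trace X D) =
  \sum_(K : {ffun 'I_d -> window} | [forall i, increasing (K i)])
    (matches X K)%:R *
    \prod_i (c0 i #|survivors D i :&: [set y : 'I_n | (y < K i ord0)%N]|%SET *
      (c1 i #|survivors D i :&: gaps (K i)|%SET *
      (c2 i #|survivors D i :&: [set y : 'I_n | (K i ord_max < y)%N]|%SET *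
      ([set K i s | s : 'I_W.+1]%SET \subset survivors D i)%:R))).
Proof.
pose h (K : {ffun 'I_d -> window}) : {ffun 'I_d -> window} :=
  [ffun i => [ffun s => rank (survivors D i) (K i s)]].
pose h' (K : {ffun 'I_d -> window}) : {ffun 'I_d -> window} :=
  [ffun i => [ffun s => unrank (survivors D i) (K i s)]].
rewrite /statistic (reindex_onto h h') /=; last first.
  move=> J /andP[_ /forallP J_lt]; apply/ffunP => i; apply/ffunP => s.
  by rewrite !ffunE unrankK // (forallP (J_lt i)).
pose surv (K : {ffun 'I_d -> window}) := [forall i, forall s : 'I_W.+1, K i s \in survivors D i].
have survP (K : {ffun 'I_d -> window}) :
    reflect (forall i (s : 'I_W.+1), K i s \in survivors D i) (surv K).
  by apply: (iffP forallP) => [H i|H i]; apply/forallP.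
rewrite (bigID surv) /= addrC [RHS](bigID surv) /= addrC.
have h_surv (K : {ffun 'I_d -> window}) : surv K ->
  ([forall i, increasing (h K i)] && [forall i, forall s : 'I_W.+1, (h K i s < #|survivors D i|)%N]
   && (h' (h K) == K)) = [forall i, increasing (K i)].
  move=> /survP KS.
  have -> : [forall i, increasing (h K i)] = [forall i, increasing (K i)].
    apply: eq_forallb => i; apply: eq_forallb => s; apply: eq_forallb => t.
    by rewrite !ffunE rank_mono.
  have -> : [forall i, forall s : 'I_W.+1, (h K i s < #|survivors D i|)%N].
    by apply/forallP => i; apply/forallP => s; rewrite !ffunE rank_lt.
  rewrite andbT; have -> : h' (h K) == K; last by rewrite andbT.
  by apply/eqP/ffunP => i; apply/ffunP => s; rewrite !ffunE rankK.
congr (_ + _).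
  apply: eq_big => [K|K].
    by have [KS|] := boolP (surv K); rewrite ?andbF // !andbT h_surv.
  move=> /andP[KD KS]; have /survP KS' := KS.
  rewrite h_surv // in KD; have {}KD i := forallP KD i.
  congr (_%:R * _).
    congr nat_of_bool; apply: eq_forallb => s; congr (_ ==> (_ == _)).
    rewrite -(entry_trace X (fun i => KS' i (s i))).
    by congr entry; apply/funext => i; rewrite !ffunE.
  apply: eq_bigr => i _; rewrite !ffunE rank_gaps // rank_above // rank_below //.
  rewrite (_ : _ \subset _) ?mulr1 //.
  by apply/fintype.subsetP => _ /imsetP[s _ ->].
(* On the left, [h' (h K) = K] forces every slice of [K] to survive; on the right, a deleted slice
   makes one factor vanish. *)
rewrite big1 => [|K /andP[/andP[/andP[_ h_lt] /eqP hK] /negP[]]]; last first.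
  apply/survP => i s; rewrite -hK !ffunE unrank_in //.
  by have := forallP (forallP h_lt i) s; rewrite !ffunE.
rewrite big1 // => K /andP[_ KS].
have [i iS] : exists i, ~~ ([set K i s | s : 'I_W.+1]%SET \subset survivors D i).
  move: KS; rewrite negb_forall => /existsP[i]; rewrite negb_forall => /existsP[s Ks].
  exists i; apply/negP => /fintype.subsetP /(_ (K i s)); rewrite (negbTE Ks).
  by rewrite imset_f // => /(_ isT).
by rewrite (bigD1 i) //= (negbTE iS) !(mulr0, mul0r).
Qed.

Variables (q : R).

Lemma mean_statistic (X : cube n d) :
  \sum_(D : {set 'I_d * 'I_n}) deletion_prob q D * statistic (trace X D) =
  \sum_(K : {ffun 'I_d -> window} | [forall i, increasing (K i)])
    (matches X K)%:R *
    \prod_i (bin_mean q (c0 i) (K i ord0) *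
      (bin_mean q (c1 i) (K i ord_max - K i ord0 - W)%N *
      (bin_mean q (c2 i) (n.-1 - K i ord_max)%N * (1 - q) ^+ W.+1))).
Proof.
under eq_bigr do rewrite statistic_trace mulr_sumr.
rewrite exchange_big /=; apply: eq_bigr => K /forallP K_incr.
under eq_bigr do rewrite mulrCA.
rewrite -mulr_sumr; congr (_ * _).
rewrite (deletion_prob_prod q (fun i S =>
   c0 i #|S :&: [set y : 'I_n | (y < K i ord0)%N]|%SET *
      (c1 i #|S :&: gaps (K i)|%SET *
      (c2 i #|S :&: [set y : 'I_n | (K i ord_max < y)%N]|%SET *
      ([set K i s | s : 'I_W.+1]%SET \subset S)%:R)))).
(* The slices before, in the gaps of, after and on the window form pairwise disjoint sets, hence
   survive independently. *)
apply: eq_bigr => i _; rewrite survival_window_mean.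
- rewrite card_below card_gaps // card_above card_imset ?card_ord //.
  exact: increasing_inj.
- apply/pred0P => y; rewrite /= !inE; apply/negbTE/negP; lia.
- have := increasing_le (s := ord0) (t := ord_max) (K_incr i) (leq0n _).
  move=> ?; apply/pred0P => y; rewrite /= !inE; apply/negbTE/negP; lia.
- apply/pred0P => y; rewrite /= !inE; apply/negbTE/negP => /andP[/and3P[]]; lia.
- apply/pred0P => y; rewrite /= !inE; apply/negbTE/negP => /andP[y0 /imsetP[s _ ys]].
  have := increasing_le (s := ord0) (t := s) (K_incr i) (leq0n _).
  by rewrite -ys leqNgt y0.
- apply/pred0P => y; rewrite /= !inE; apply/negbTE/negP => /andP[/and3P[_ _ yK] /imsetP[s _ ys]].
  by rewrite ys codom_f in yK.
- apply/pred0P => y; rewrite /= !inE; apply/negbTE/negP => /andP[y0 /imsetP[s _ ys]].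
  have := increasing_le (s := s) (t := ord_max) (K_incr i) (leq_ord _).
  by rewrite -ys leqNgt y0.
Qed.

Lemma statistic_bound (B : R) (X : cube n d) (D : {set 'I_d * 'I_n}) :
  (forall i j, (j <= n)%N -> `|c0 i j| <= B) ->
  (forall i j, (j <= n)%N -> `|c1 i j| <= B) ->
  (forall i j, (j <= n)%N -> `|c2 i j| <= B) ->
  `|statistic (trace X D)| <= (n ^ (W.+1 * d))%:R * (B ^+ 3) ^+ d.
Proof.
move=> b0 b1 b2.
have le_n (A : {set 'I_n}) : (#|A| <= n)%N by rewrite -[leqRHS](card_ord n) max_card.
apply: (le_trans (ler_norm_sum _ _ _)).
apply: (@le_trans _ _ (\sum_(J : {ffun 'I_d -> window}) (B ^+ 3) ^+ d)); last first.
  by rewrite sumr_const !card_ffun !card_ord -expnM mulr_natl.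
have B0 (i : 'I_d) : 0 <= B by exact: le_trans (normr_ge0 _) (b0 i 0 (leq0n _)).
rewrite big_mkcond /=; apply: ler_sum => J _.
have Bd0 : 0 <= (B ^+ 3) ^+ d.
  have [->|] := posnP d; first by [].
  by move=> d0; rewrite !exprn_ge0 // (B0 (Ordinal d0)).
case: ifP => // /andP[_ /forallP J_lt].
rewrite normrM -[leRHS]mul1r; apply: ler_pM => //.
  by rewrite normr_nat; case: [forall s, _].
rewrite normr_prod -[X in _ ^+ X](card_ord d) -prodr_const.
apply: ler_prod => i _; rewrite normr_ge0 /= !normrM exprS expr2.
have lt_n s : (J i s < n)%N by exact: ltn_ord.
rewrite ler_pM ?mulr_ge0 ?b0 ?ler_pM ?b1 ?b2 // ?(ltnW (lt_n _)) //.
  by rewrite (leq_trans (leq_subr _ _)) // (leq_trans (leq_subr _ _)) // ltnW.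
by rewrite (leq_trans (leq_subr _ _)) // (leq_trans (leq_pred _)).
Qed.

End Statistic.

(** * A pattern that tells two hypermatrices apart *)

Section SeparatingPattern.
Variables (n d W : nat).
Local Notation window := {ffun 'I_W.+1 -> 'I_n}.
Local Notation offset := {ffun 'I_d -> 'I_W.+1}.
Local Notation point := {dffun forall i : 'I_d, 'I_n}.
Local Notation V := {ffun 'I_d -> int}.

(** Base-[n] value. It is additive on integer vectors and orders the indices of a cube
    lexicographically, the last coordinate being the most significant. *)
Definition lam (v : V) : int := \sum_(i < d) v i * (n ^ i)%N%:Z.

Lemma lamD (u v : V) : lam (u + v) = lam u + lam v.
Proof. by rewrite -big_split /=; apply: eq_bigr => i _; rewrite ffunE mulrDl. Qed.

Lemma lamN (v : V) : lam (- v) = - lam v.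
Proof. by rewrite -sumrN; apply: eq_bigr => i _; rewrite ffunE mulNr. Qed.

(** If [i] is the least index with [v i != 0], all other terms are divisible by [n^(i + 1)], hence
    so is [v i * n^i]; then [n] divides [v i], which is too small for that. *)
Lemma lam_eq0 (v : V) : (forall i, (`|v i| < n)%N) -> lam v = 0 -> v = 0.
Proof.
move=> v_lt lam0; apply/eqP/negPn/negP => v0.
have [i0 vi0] : exists i0, v i0 != 0.
  apply/existsP; rewrite -negb_forall; apply: contra v0 => /forallP v0.
  by apply/eqP/ffunP => i; rewrite ffunE; apply/eqP.
case: (@arg_minnP _ i0 (fun i => v i != 0) val vi0) => i vi i_min {i0 vi0}.
have n0 : (0 < n)%N by apply: leq_ltn_trans (v_lt i).
have : ((n ^ i.+1)%N%:Z %| v i * (n ^ i)%N%:Z)%Z.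
  have /eqP : lam v = v i * (n ^ i)%N%:Z + \sum_(j < d | j != i) v j * (n ^ j)%N%:Z.
    by rewrite /lam (bigD1 i).
  rewrite lam0 eq_sym addr_eq0 => /eqP ->; rewrite rpredN.
  apply: rpred_sum => j ji.
  have [->|vj] := eqVneq (v j) 0; first by rewrite mul0r dvdz0.
  apply: dvdz_mull; rewrite dvdzE /= dvdn_exp2l //.
  by rewrite ltn_neqAle i_min // andbT eq_sym -val_eqE in ji *.
rewrite expnS PoszM dvdz_mul2r; last by rewrite -lt0n expn_gt0 n0.
by rewrite dvdzE /= gtnNdvd // absz_gt0.
Qed.

Definition emb (g : point) : V := [ffun i => (g i)%:Z].

Lemma emb_inj : injective emb.
Proof.
move=> g h /ffunP gh; apply/ffunP => i; apply: val_inj.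
by have := gh i; rewrite !ffunE => -[].
Qed.

(* If [x] has period [v] and [y] has period [v'], the value at [k] of each of
   them equals their common value at [k - v - v']. *)
Lemma periods_differ (x y : V -> bool) (S : pred V) (k v v' : V) :
  (forall u, S u -> u != k -> x u = y u) -> x k != y k ->
  v != 0 -> v' != 0 -> v + v' != 0 ->
  S k -> S (k - v) -> S (k - v') -> S (k - v - v') ->
  (forall u, S u -> S (u - v) -> x u = x (u - v)) ->
  (forall u, S u -> S (u - v') -> y u = y (u - v')) -> False.
Proof.
move=> xy xyk v0 v0' vv0 Sk Skv Skv' Skvv' xv yv'.
have neq w (w0 : w != 0) : k - w != k.
  by rewrite -subr_eq0 addrAC subrr sub0r oppr_eq0.
have e1 := xy _ Skv (neq v v0); have e2 := xy _ Skv' (neq v' v0').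
have e3 : x (k - v - v') = y (k - v - v') by apply: xy; rewrite // -addrA -opprD neq.
have e4 : k - v' - v = k - v - v' by rewrite addrAC.
move/eqP: xyk; apply.
rewrite (xv k Sk Skv) e1 (yv' _ Skv Skvv') (yv' k Sk Skv') -e2.
by rewrite (xv _ Skv') e4.
Qed.

Definition consecutive (K : {ffun 'I_d -> window}) : bool :=
  [forall i, forall s : 'I_W.+1, (K i s == K i ord0 + s :> nat)%N].

Definition near_starts (a r : 'I_d -> nat) (K : {ffun 'I_d -> window}) : bool :=
  [forall i, (`|(K i ord0)%:Z - (a i)%:Z| <= r i)%N].

(** The second clause can speak of every [Z]: a pattern without short periods cannot occur at two
    nearby places, whatever surrounds it. *)
Definition discriminates (a r : 'I_d -> nat) pat w (X Y : cube n d) : Prop :=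
  (forall K : {ffun 'I_d -> window}, consecutive K ->
    (forall i, K i ord0 = a i :> nat) ->
    matches pat w X K && ~~ matches pat w Y K) /\
  (forall (Z : cube n d) (K K' : {ffun 'I_d -> window}),
    consecutive K -> consecutive K' ->
    near_starts a r K -> near_starts a r K' ->
    matches pat w Z K -> matches pat w Z K' -> K = K').

(** The point [k] is the least difference with respect to [lam]. The pattern copies [X] or [Y],
    whichever has no short period, on the part of the window not after [k]. Two starts within [r] of
    [a] differ by at most [2 r], and [periods_differ] subtracts two such vectors from [k]; hence the
    margin [4 r]. *)
Lemma separating_pattern (X Y : cube n d) : X <> Y ->
  exists k : point, forall a r : 'I_d -> nat,
    (forall i, (a i + 4 * r i <= k i)%N) ->
    (forall i, (k i + 4 * r i <= a i + W)%N) ->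
    (forall i, (a i + W < n)%N) ->
    exists pat : pred offset, exists w : offset -> bool,
      discriminates a r pat w X Y \/ discriminates a r pat w Y X.
Proof.
move=> XY.
have [k0 k0P] : exists k, X k != Y k.
  apply/existsP; rewrite -negb_forall; apply/negP => /forallP XY'.
  by apply: XY; apply/ffunP => g; exact/eqP.
have lam_emb g : lam (emb g) = `|lam (emb g)|%N.
  rewrite gez0_abs // sumr_ge0 // => i _; rewrite mulr_ge0 // ffunE //.
case: (@arg_minnP _ k0 (fun k => X k != Y k) (fun k => `|lam (emb k)|%N) k0P)
  => k kP k_min {k0 k0P}.
exists k => a r ak ka aW.
(* Extended to integer vectors so that periods can be subtracted; the default [k i] is not met
   inside the window. *)
pose ext (Z : cube n d) (v : V) : bool :=
  Z [ffun i => insubd (k i) `|v i|%N].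
have extE Z (v : V) (g : point) : v = emb g -> ext Z v = Z g.
  move=> ->; congr (Z _); apply/ffunP => i; apply: val_inj.
  by rewrite !ffunE /= val_insubd ltn_ord.
pose at_ (b : 'I_d -> nat) (s : offset) : V := [ffun i => (b i + s i)%N%:Z].
pose S (v : V) := [forall i, (a i)%:Z <= v i <= (a i + W)%N%:Z] &&
  (lam v <= lam (emb k)).
pose pat : pred offset := fun s => lam (at_ a s) <= lam (emb k).
have S_at (v : V) : S v -> exists2 s, pat s & v = at_ a s.
  move=> /andP[/forallP v_itv v_lam].
  have vE : v = at_ a [ffun i => inord `|v i - (a i)%:Z|%N].
    apply/ffunP => i; rewrite !ffunE inordK; have := v_itv i; move: (v i) (a i) => x y; clear; lia.
  by exists [ffun i => inord `|v i - (a i)%:Z|%N]; rewrite /pat -?vE.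
have at_in (s : offset) : pat s -> S (at_ a s).
  move=> ps; apply/andP; split=> //; apply/forallP => i; rewrite ffunE.
  by have := ltn_ord (s i); move: (nat_of_ord (s i)) (a i) => x y; clear; lia.
have embk_itv i : (a i)%:Z <= emb k i <= (a i + W)%N%:Z.
  rewrite ffunE; have := ak i; have := ka i.
  by move: (nat_of_ord (k i)) (a i) (r i) => x y z; clear; lia.
have Sk : S (emb k) by rewrite /S lexx andbT; apply/forallP.
(* Displacements between nearby occurrences, with the sign for which subtraction moves backwards in
   the order and the sum of two of them is nonzero. *)
pose short (v : V) := [forall i, (`|v i| <= 2 * r i)%N] && (0 < lam v).
have short_neq0 (v : V) : 0 < lam v -> v != 0.
  apply: contraTneq => ->; rewrite -leNgt.
  by rewrite /lam big1 // => i _; rewrite ffunE mul0r.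
have S_short (v : V) : short v -> S (emb k - v).
  move=> /andP[/forallP v_short v_lam]; apply/andP; split; last first.
    by rewrite lamD lamN gerBl ltW.
  apply/forallP => i; have := v_short i; have := ak i; have := ka i.
  by rewrite !ffunE; move: (v i) (nat_of_ord (k i)) (a i) (r i) => x y z t; clear; lia.
have S_short2 (v v' : V) : short v -> short v' -> S (emb k - v - v').
  move=> /andP[/forallP v_short v_lam] /andP[/forallP v_short' v_lam'].
  apply/andP; split; last first.
    rewrite !lamD !lamN; move: (lam v) (lam v') (lam (emb k)) v_lam v_lam' => x y z.
    by clear; lia.
  apply/forallP => i; have := v_short i; have := v_short' i.
  have := ak i; have := ka i; rewrite !ffunE.
  move: (v i) (v' i) (nat_of_ord (k i)) (a i) (r i) => x x' y z t; clear; lia.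
pose aperiodic (x : V -> bool) := forall v : V, short v ->
  exists u, [/\ S u, S (u - v) & x u != x (u - v)].
have XY_S (u : V) : S u -> u != emb k -> ext X u = ext Y u.
  move=> /andP[/forallP u_itv u_lam] uk.
  have u_lt i : (`|u i| < n)%N.
    by have := u_itv i; have := aW i; move: (u i) (a i) => x y; clear; lia.
  pose g : point := [ffun i => Ordinal (u_lt i)].
  have ug : u = emb g.
    apply/ffunP => i; rewrite !ffunE /=; have := u_itv i.
    by move: (u i) (a i) => x y; clear; lia.
  rewrite !(extE _ _ g) //; apply/eqP/negPn/negP => /k_min.
  rewrite -lez_nat -!lam_emb -ug => ku.
  have /eqP := le_anti (introT andP (conj u_lam ku)).
  rewrite -subr_eq0 -lamN -lamD => /eqP /lam_eq0 u0.
  move: uk; rewrite -subr_eq0 u0 ?eqxx // => i; rewrite !ffunE.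
  have := u_itv i; have := ltn_ord (k i); have := aW i.
  by move: (u i) (a i) (nat_of_ord (k i)) => x y z; clear; lia.
suff disc (A B : cube n d) : aperiodic (ext A) -> A k != B k ->
    discriminates a r pat (fun s => ext A (at_ a s)) A B.
  have [aX|aY] : aperiodic (ext X) \/ aperiodic (ext Y).
    apply: contrapT => /not_orP[] /existsNP[v /not_implyP[v_short vX]]
      /existsNP[v' /not_implyP[v_short' vY]].
    apply: (@periods_differ (ext X) (ext Y) S (emb k) v v') => //.
    - by rewrite !(extE _ _ k).
    - by apply: short_neq0; case/andP: v_short.
    - by apply: short_neq0; case/andP: v_short'.
    - by apply: short_neq0; rewrite lamD addr_gt0 //; [case/andP: v_short|case/andP: v_short'].
    - exact: S_short.
    - exact: S_short.
    - exact: S_short2.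
    - move=> u Su Suv; apply/eqP/negPn/negP => xu; apply: vX; by exists u.
    - move=> u Su Suv; apply/eqP/negPn/negP => xu; apply: vY; by exists u.
    by exists pat, (fun s => ext X (at_ a s)); left; exact: disc.
  by exists pat, (fun s => ext Y (at_ a s)); right; apply: disc; rewrite 1?eq_sym.
move=> aA ABk.
have occE (Z : cube n d) (K : {ffun 'I_d -> window}) (s : offset) : consecutive K ->
    emb [ffun i => K i (s i)] = at_ (fun i => K i ord0) s.
  move=> /forallP KC; apply/ffunP => i; rewrite !ffunE.
  by rewrite (eqP (forallP (KC i) (s i))).
split=> [K KC Ka|].
  have at_K s : at_ (fun i => K i ord0) s = at_ a s.
    by apply/ffunP => i; rewrite !ffunE Ka.
  apply/andP; split.
    apply/forallP => s; apply/implyP => _; apply/eqP.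
    by rewrite (extE A _ [ffun i => K i (s i)]) // occE.
  have [s ps kE] := S_at _ Sk.
  apply/negP => /forallP /(_ s); rewrite ps /=; apply/negP.
  have sE : [ffun i => K i (s i)] = k.
    by apply: emb_inj; rewrite occE // at_K.
  by rewrite sE -kE (extE A _ k) // eq_sym.
(* If occurrences are displaced by [u], the offset of [p] in the first and that of [p - u] in the
   second read the same entry of [Z], so [u] would be a short period. Exchanging [K] and [K'] later
   excludes the other sign. *)
have noperiod (Z : cube n d) (K K' : {ffun 'I_d -> window}) :
    consecutive K -> consecutive K' -> near_starts a r K -> near_starts a r K' ->
    matches pat (fun s => ext A (at_ a s)) Z K ->
    matches pat (fun s => ext A (at_ a s)) Z K' ->
    ~~ (0 < lam [ffun i => (K' i ord0)%:Z - (K i ord0)%:Z]).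
  set u : V := finfun _ => KC KC' /forallP Kn /forallP Kn' /forallP KM /forallP KM'.
  apply/negP => u_lam.
  have /aA[p [Sp Spu]] : short u.
    apply/andP; split=> //; apply/forallP => i; rewrite ffunE.
    have := Kn i; have := Kn' i; move: (nat_of_ord (K i ord0)) => x.
    by move: (nat_of_ord (K' i ord0)) (a i) (r i) => y z t; clear; lia.
  have [s ps pE] := S_at _ Sp; have [s' ps' puE] := S_at _ Spu.
  have := KM s; rewrite ps /= -pE => /eqP <-.
  have := KM' s'; rewrite ps' /= -puE => /eqP <-.
  move/eqP; apply; congr (Z _); apply: emb_inj; rewrite !occE //.
  apply/ffunP => i; move/ffunP/(_ i): puE; rewrite pE !ffunE.
  move: (nat_of_ord (K i ord0)) (nat_of_ord (K' i ord0)) (a i) => x y z.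
  by move: (nat_of_ord (s i)) (nat_of_ord (s' i)) => e e'; clear; lia.
move=> Z K K' KC KC' Kn Kn' KM KM'.
have st : [ffun i => (K' i ord0)%:Z - (K i ord0)%:Z] = 0 :> V.
  apply: lam_eq0 => [i|].
    rewrite ffunE; have := forallP Kn i; have := forallP Kn' i.
    have := ak i; have := ka i; have := aW i; move: (nat_of_ord (K i ord0)) => x.
    move: (nat_of_ord (K' i ord0)) (a i) (r i) (nat_of_ord (k i)) => y z t e.
    by clear; lia.
  apply/eqP; have [l0|l0|//] := ltgtP _ 0.
    have /negP[] := noperiod Z K' K KC' KC Kn' Kn KM' KM.
    rewrite (_ : finfun _ = - [ffun i => (K' i ord0)%:Z - (K i ord0)%:Z]) ?lamN ?oppr_gt0 //.
    by apply/ffunP => i; rewrite !ffunE opprB.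
  by have /negP[] := noperiod Z K K' KC KC' Kn Kn' KM KM'.
apply/ffunP => i; apply/ffunP => s; apply: val_inj => /=.
rewrite (eqP (forallP (forallP KC i) s)) (eqP (forallP (forallP KC' i) s)).
move/ffunP/(_ i): st; rewrite !ffunE => /eqP; rewrite subr_eq0 => /eqP[<-] //.
Qed.

End SeparatingPattern.

(** * Lower bound on the difference of the mean statistics *)

Section MeanDifference.
Variables (R : realType) (q : R) (n W : nat).
Local Notation window := {ffun 'I_W.+1 -> 'I_n}.

Lemma increasing_add (K : window) (s t : 'I_W.+1) : increasing K ->
  (s <= t)%N -> (K s + (t - s) <= K t)%N.
Proof.
move=> /increasingP K_incr; case: t => t tW /=; elim: t tW => [|t IH] tW.
  by rewrite leqn0 => /eqP s0; rewrite s0 addn0 (_ : Ordinal tW = s) //; exact: val_inj.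
rewrite leq_eqVlt => /orP[/eqP st|].
  by rewrite st subnn addn0 (_ : Ordinal tW = s) //; exact: val_inj.
rewrite ltnS => st; rewrite subSn // addnS.
by apply: leq_ltn_trans (IH (ltnW tW) st) _; apply: K_incr.
Qed.

Lemma increasing_consecutive (K : window) : increasing K ->
  (K ord_max - K ord0 - W)%N = 0%N ->
  forall s, K s = (K ord0 + s)%N :> nat.
Proof.
move=> K_incr gap0 s.
have := increasing_add (s := ord0) (t := s) K_incr (leq0n _).
have := increasing_add (s := s) (t := ord_max) K_incr (leq_ord _).
have := leq_ord s; move: gap0; rewrite /= subn0.
move: (nat_of_ord (K s)) (nat_of_ord (K ord0)) (nat_of_ord (K ord_max)) => x y z.
by move: (nat_of_ord s) => t; clear; lia.
Qed.

(* [c0], [c1] and [c2] are applied to the numbers of survivors before, inside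
   and after a window of [W.+1] survivors. *)
Definition localizes (eta eps del : R) (a r : nat) (c0 c1 c2 : nat -> R) : Prop :=
  [/\ forall m, (m <= n)%N -> `|bin_mean q c0 m| <= 1 /\ `|bin_mean q c2 m| <= 1,
      bin_mean q c1 0 = 1 /\
        (forall m, (0 < m)%N -> (m <= n)%N -> `|bin_mean q c1 m| <= del),
      bin_mean q c0 a * bin_mean q c2 (n.-1 - (a + W)) = 1,
      forall b, (b + W < n)%N -> b != a -> (`|b%:Z - a%:Z| <= r)%N ->
        0 <= bin_mean q c0 b * bin_mean q c2 (n.-1 - (b + W)) <= 1 - eta &
      forall b, (b + W < n)%N -> (r < `|b%:Z - a%:Z|)%N ->
        `|bin_mean q c0 b * bin_mean q c2 (n.-1 - (b + W))| <= eps].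

Lemma prodr_norm_le (I : finType) (F : I -> R) (i : I) (e : R) :
  (forall j, `|F j| <= 1) -> `|F i| <= e -> `|\prod_j F j| <= e.
Proof.
move=> F1 Fi; rewrite (bigD1 i) //= normrM -[leRHS]mulr1.
apply: ler_pM => //; rewrite normr_prod; apply: prodr_ile1 => j _.
by rewrite normr_ge0 F1.
Qed.

Lemma sum_ge_card (I : finType) (P : pred I) (f : I -> R) (e : R) (N : nat) :
  0 <= e -> (forall i, P i -> - e <= f i) -> (#|P| <= N)%N ->
  - (N%:R * e) <= \sum_(i | P i) f i.
Proof.
move=> e0 fe PN; apply: (@le_trans _ _ (\sum_(i | P i) - e)).
  rewrite sumr_const mulNrn lerN2 -[leLHS]mulr_natl.
  by apply: ler_wpM2r => //; rewrite ler_nat.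
exact: ler_sum.
Qed.

Lemma card_windows d : #|{: {ffun 'I_d -> window}}| = (n ^ (W.+1 * d))%N.
Proof. by rewrite card_ffun card_ffun !card_ord -expnM. Qed.

Lemma card_consecutive d :
  (#|[pred K : {ffun 'I_d -> window} | consecutive K]| <= n ^ d)%N.
Proof.
pose st (K : {ffun 'I_d -> window}) : {ffun 'I_d -> 'I_n} := [ffun i => K i ord0].
have -> : (n ^ d)%N = #|{: {ffun 'I_d -> 'I_n}}| by rewrite card_ffun !card_ord.
rewrite -(card_in_imset (f := st)); first exact: max_card.
move=> K K'; rewrite !inE => KC KC' KK'.
apply/ffunP => i; apply/ffunP => s; apply: val_inj => /=.
rewrite (eqP (forallP (forallP KC i) s)) (eqP (forallP (forallP KC' i) s)).
by move/ffunP/(_ i): KK'; rewrite !ffunE => ->.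
Qed.

(** Among the consecutive windows near [a], [X] has exactly one occurrence, at [a] and of weight 1,
    while [Y] has at most one, elsewhere and so of weight at most [1 - eta]. The other windows are
    errors: [eps] for each consecutive one far from [a], [del] for each one with a gap. *)
Lemma mean_difference (d : nat) (eta eps del : R) (a r : 'I_d -> nat)
    (c0 c1 c2 : 'I_d -> nat -> R) (pat : pred {ffun 'I_d -> 'I_W.+1})
    (w : {ffun 'I_d -> 'I_W.+1} -> bool) (X Y : cube n d) :
  eta <= 1 -> 0 <= eps -> 0 <= del <= 1 -> q < 1 ->
  (forall i, (a i + W < n)%N) ->
  (forall i, localizes eta eps del (a i) (r i) (c0 i) (c1 i) (c2 i)) ->
  discriminates a r pat w X Y ->
  ((1 - q) ^+ W.+1) ^+ d *
    (eta - (n ^ d)%:R * eps - (n ^ (W.+1 * d))%:R * del) <=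
  \sum_D deletion_prob q D * statistic n pat w c0 c1 c2 (trace X D) -
  \sum_D deletion_prob q D * statistic n pat w c0 c1 c2 (trace Y D).
Proof.
move=> eta1 eps0 /andP[del0 del1] q1 aW loc [occ_a uniq_occ].
have n0 i : (0 < n)%N := leq_ltn_trans (leq0n _) (aW i).
pose B0 i m := bin_mean q (c0 i) m; pose B1 i m := bin_mean q (c1 i) m.
pose B2 i m := bin_mean q (c2 i) m.
pose F (K : {ffun 'I_d -> window}) i := B0 i (K i ord0) *
  (B1 i (K i ord_max - K i ord0 - W)%N * B2 i (n.-1 - K i ord_max)%N).
pose wt (K : {ffun 'I_d -> window}) := \prod_i F K i.
have meanE (Z : cube n d) :
    \sum_D deletion_prob q D * statistic n pat w c0 c1 c2 (trace Z D) =
    ((1 - q) ^+ W.+1) ^+ d * \sum_(K : {ffun 'I_d -> window} |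
      [forall i, increasing (K i)]) (matches pat w Z K)%:R * wt K.
  rewrite mean_statistic mulr_sumr; apply: eq_bigr => K _.
  rewrite mulrCA; congr (_ * _).
  rewrite -[X in _ = _ ^+ X * _](card_ord d) -prodr_const -big_split /=.
  by apply: eq_bigr => i _; rewrite /F /B0 /B1 /B2; ring.
rewrite !meanE -mulrBr; apply: ler_wpM2l.
  by rewrite !exprn_ge0 // subr_ge0 ltW.
have B01 i m : (m <= n)%N -> `|B0 i m| <= 1 by case: (loc i) => + _ _ _ _ => /[apply] -[].
have B21 i m : (m <= n)%N -> `|B2 i m| <= 1 by case: (loc i) => + _ _ _ _ => /[apply] -[].
have B1d i m : (0 < m)%N -> (m <= n)%N -> `|B1 i m| <= del by case: (loc i) => _ [_ +] _ _ _; exact.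
have B10 i : B1 i 0 = 1 by case: (loc i) => _ [].
have B11 i m : (m <= n)%N -> `|B1 i m| <= 1.
  by case: m => [|m] mn; rewrite ?B10 ?normr1 // (le_trans (B1d _ _ _ mn)).
have le_n (x : 'I_n) y z : ((x - y - z)%N <= n)%N.
  by rewrite (leq_trans (leq_subr _ _)) // (leq_trans (leq_subr _ _)) // ltnW.
have B2n x : (n.-1 - x <= n)%N by rewrite (leq_trans (leq_subr _ _)) // leq_pred.
have F1 K i : `|F K i| <= 1.
  rewrite /F !normrM mulr_ile1 ?mulr_ge0 ?B01 ?(ltnW (ltn_ord _)) //.
  by rewrite mulr_ile1 ?B11 ?B21.
have wt_gap (K : {ffun 'I_d -> window}) : [forall i, increasing (K i)] ->
    ~~ consecutive K -> `|wt K| <= del.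
  move=> /forallP K_incr; rewrite negb_forall => /existsP[i Ki].
  apply: (prodr_norm_le (i := i)) => //.
  have gap : (0 < K i ord_max - K i ord0 - W)%N.
    rewrite lt0n; apply: contra Ki => /eqP gap0; apply/forallP => s.
    by rewrite (increasing_consecutive (K_incr i) gap0).
  rewrite /F !normrM -[leRHS]mul1r ler_pM ?mulr_ge0 ?B01 ?(ltnW (ltn_ord _)) //.
  by rewrite -[leRHS]mulr1 ler_pM ?B1d ?B21.
pose th i b := B0 i b * B2 i (n.-1 - (b + W))%N.
have consE (K : {ffun 'I_d -> window}) i s : consecutive K ->
    K i s = (K i ord0 + s)%N :> nat.
  by move=> /forallP /(_ i) /forallP /(_ s) /eqP.
have FE K i : consecutive K -> F K i = th i (K i ord0).
  move=> KC; rewrite /F (consE K i ord_max) //= addKn subnn B10 mul1r //.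
have KW (K : {ffun 'I_d -> window}) i : consecutive K -> (K i ord0 + W < n)%N.
  by move=> KC; have := consE K i ord_max KC => /= <-.
have wt_far K : consecutive K -> ~~ near_starts a r K -> `|wt K| <= eps.
  move=> KC; rewrite negb_forall => /existsP[i]; rewrite -ltnNge => Ki.
  apply: (prodr_norm_le (i := i)) => //.
  by rewrite FE //; case: (loc i) => _ _ _ _; apply => //; exact: KW.
(* The window starting at [a]; the default of [insubd] is not reached because [a i + W < n]. *)
pose Ka : {ffun 'I_d -> window} :=
  [ffun i => [ffun s : 'I_W.+1 => insubd (Ordinal (aW i)) (a i + s)%N]].
have KaE i s : Ka i s = (a i + s)%N :> nat.
  rewrite !ffunE val_insubd ifT //; apply: leq_ltn_trans (aW i).
  by rewrite leq_add2l leq_ord.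
have Ka_cons : consecutive Ka.
  by apply/forallP => i; apply/forallP => s; rewrite !KaE addn0.
have Ka_near : near_starts a r Ka.
  by apply/forallP => i; rewrite KaE addn0 subrr.
have Ka_incr : [forall i, increasing (Ka i)].
  apply/forallP => i; apply/increasingP => s t st.
  by rewrite !KaE ltn_add2l.
have /andP[XKa YKa] : matches pat w X Ka && ~~ matches pat w Y Ka.
  by apply: occ_a => // i; rewrite KaE addn0.
have wt_Ka : wt Ka = 1.
  rewrite /wt big1 // => i _; rewrite FE // KaE addn0.
  by case: (loc i).
have wt_near (K : {ffun 'I_d -> window}) : consecutive K -> near_starts a r K -> K != Ka ->
    0 <= wt K <= 1 - eta.
  move=> KC /forallP Kn KKa.
  have [i Ki] : exists i, (K i ord0 != a i :> nat).
    apply/existsP; rewrite -negb_forall; apply: contra KKa => /forallP Ka0.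
    apply/eqP/ffunP => i; apply/ffunP => s; apply: val_inj => /=.
    by rewrite KaE consE // (eqP (Ka0 i)).
  have F0 j : 0 <= F K j.
    rewrite FE //; have [->|Kj] := eqVneq (K j ord0 : nat) (a j).
      by case: (loc j) => _ _ + _ _; rewrite /th /B0 /B2 => ->.
    by case: (loc j) => _ _ _ + _ => /(_ _ (KW K j KC) Kj (Kn j)) /andP[].
  have wt0 : 0 <= wt K by apply: prodr_ge0.
  rewrite wt0 /= -(ger0_norm wt0); apply: (prodr_norm_le (i := i)) => //.
  rewrite ger0_norm // FE //.
  by case: (loc i) => _ _ _ + _ => /(_ _ (KW K i KC) Ki (Kn i)) /andP[].
rewrite -sumrB.
rewrite (eq_bigr (fun K => ((matches pat w X K)%:R - (matches pat w Y K)%:R) * wt K));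
  last by move=> K _; rewrite mulrBl.
have dM (K : {ffun 'I_d -> window}) : `|(matches pat w X K)%:R - (matches pat w Y K)%:R| <= 1 :> R.
  by case: (matches pat w X K); case: (matches pat w Y K);
    rewrite ?subrr ?subr0 ?sub0r ?normr0 ?normrN ?normr1.
have low (K : {ffun 'I_d -> window}) e : `|wt K| <= e ->
    - e <= ((matches pat w X K)%:R - (matches pat w Y K)%:R) * wt K.
  move=> we; rewrite lerNl; apply: le_trans (ler_norm _) _.
  by rewrite normrN normrM -[leRHS]mul1r ler_pM.
(* The three parts are the consecutive windows near [a], the consecutive ones far from it, and those
   with a gap. *)
rewrite (bigID (fun K => consecutive K)) /= (bigID (near_starts a r)) /=.
rewrite -!addrA; apply: lerD; [|apply: lerD].
- rewrite (eq_bigr _ (fun K _ => mulrBl _ _ _)) sumrB.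
  rewrite (bigD1 Ka) ?Ka_incr ?Ka_cons //= XKa mul1r wt_Ka big1 ?addr0; last first.
    move=> K /andP[/andP[/andP[_ KC] Kn] KKa].
    case: (boolP (matches pat w X K)); last by rewrite mul0r.
    by move=> XK; move: KKa; rewrite (uniq_occ X K Ka) ?eqxx.
  rewrite lerBrDr -lerBrDl.
  have [[K1 /and4P[K1i K1C K1n YK1]]|noY] :=
      pselect (exists K1 : {ffun 'I_d -> window}, [&& [forall i, increasing (K1 i)], consecutive K1,
        near_starts a r K1 & matches pat w Y K1]).
    rewrite (bigD1 K1) ?K1i ?K1C //= YK1 mul1r big1 ?addr0; last first.
      move=> K /andP[/andP[/andP[_ KC] Kn] KK1].
      case: (boolP (matches pat w Y K)); last by rewrite mul0r.
      by move=> YK; move: KK1; rewrite (uniq_occ Y K K1) ?eqxx.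
    have /andP[//] : 0 <= wt K1 <= 1 - eta.
    apply: wt_near => //; apply: contraTneq YK1 => ->; exact: YKa.
  (* Without an occurrence in [Y] the near part is 1, and [eta <= 1]. *)
  rewrite big1 ?subr_ge0 // => K /andP[/andP[Ki KC] Kn].
  case: (boolP (matches pat w Y K)); last by rewrite mul0r.
  by move=> YK; case: noY; exists K; rewrite Ki KC Kn.
- apply: sum_ge_card => // [K /andP[/andP[_ KC] Kn]|].
    by apply: low; exact: wt_far.
  apply: leq_trans (card_consecutive d); apply: subset_leq_card.
  by apply/fintype.subsetP => K /andP[/andP[_ KC] _].
- apply: sum_ge_card => // [K /andP[Ki KC]|].
    by apply: low; exact: wt_gap.
  rewrite -(card_windows d); exact: max_card.
Qed.

End MeanDifference.

(** * Localizing weights in one dimension *)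

Section Localizers.
Variables (R : realType) (q : R).
Hypotheses (q0 : 0 < q) (q1 : q < 1).

(* A window around [k] is located by a bump if it fits; otherwise it is
   anchored exactly at the nearby end of the side. *)
Lemma localizer_exists (n z h K k : nat) (eps B : R) :
  (0 < z)%N -> (0 < h)%N -> (0 < K)%N -> (8 * z < n)%N -> (k < n)%N ->
  2 ^- h <= eps -> q ^+ K / (1 - q ^+ 2) <= eps -> eps <= 1 -> 1 <= B ->
  3 ^+ K / (1 - q ^+ 2) <= B ->
  expR (n%:R * (q * (pi * h%:R / z%:R) ^+ 2 / (1 - q) ^+ 2)) <= B ->
  exists a r : nat, exists c0 c1 c2 : nat -> R,
    [/\ (a + 4 * r <= k)%N, (k + 4 * r <= a + 8 * z)%N, (a + 8 * z < n)%N,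
        localizes q n (8 * z) (4 * z%:R ^+ 2)^-1 eps (q ^+ K / (1 - q ^+ 2))
          a r c0 c1 c2 &
        forall j, (j <= n)%N -> [/\ `|c0 j| <= B, `|c1 j| <= B & `|c2 j| <= B]].
Proof.
move=> z0 h0 K0 zn kn eps_h eps_K eps1 B1 B_sharp B_bump.
have [s [s0 s_le s_bd]] := sharp_functional q0 q1 K0.
have s1 m : `|bin_mean q s m| <= 1.
  case: m => [|m]; first by rewrite s0 normr1.
  by rewrite (le_trans (s_le _ _)) // (le_trans eps_K).
have one_mean m : bin_mean q (fun=> 1) m = 1 by exact: bin_mean_cst.
have sB j : `|s j| <= B by exact: le_trans B_sharp.
have loc1 : bin_mean q s 0 = 1 /\ (forall m, (0 < m)%N -> (m <= n)%N ->
    `|bin_mean q s m| <= q ^+ K / (1 - q ^+ 2)).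
  by split=> // m m0 _; exact: s_le.
(* Close to 0 the window starts at 0, and [s] in the role of [c0] penalizes slices before it. With
   [r = 0] the clause on nearby starts is empty. *)
have [k_lo|k_lo] := ltnP k (4 * z).
  exists 0, 0, s, s, (fun=> 1); split;
    [by clear -z0 zn kn k_lo; lia..| |by move=> j _; rewrite normr1].
  split=> //.
  - by move=> m _; rewrite one_mean normr1.
  - by rewrite s0 one_mean mulr1.
  - by move=> b _ b0 b1; exfalso; clear -b0 b1; lia.
  - move=> b _; rewrite one_mean mulr1 => b0; apply: le_trans eps_K.
    by apply: s_le; clear -b0; lia.
(* Close to the end the window ends at the last slice, and [s] in the role of [c2] penalizes slices
   after it. *)
have [k_hi|k_hi] := ltnP (k + 4 * z) n; last first.
  exists (n.-1 - 8 * z)%N, 0, (fun=> 1), s, s.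
  split;
    [by clear -z0 zn kn k_lo k_hi; lia..| |by move=> j _; rewrite normr1].
  split=> //.
  - by move=> m _; rewrite one_mean normr1.
  - by rewrite one_mean mul1r (_ : _ - _ = 0)%N //; clear; lia.
  - by move=> b _ b0 b1; exfalso; move: b0 b1; clear -zn; lia.
  - move=> b bn; rewrite one_mean mul1r => b0; apply: le_trans eps_K.
    by apply: s_le; clear -bn b0 zn; lia.
(* In the remaining case [k] is the centre of the window, with [4 z] slices on each side, which is
   the margin for a bump of radius [z]. *)
have an : (k - 4 * z <= n)%N by clear -z0 zn kn k_lo k_hi; lia.
have [c [ca c_itv c_near c_far cB]] := bump_functional q0 q1 z0 h0 an.
exists (k - 4 * z)%N, z, c, s, (fun=> 1); split;
  [by clear -z0 zn kn k_lo k_hi; lia..| |]; last first.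
  move=> j jn; rewrite normr1; split=> //.
  apply: le_trans (cB j) _; apply: le_trans B_bump; rewrite ler_expR.
  by rewrite ler_wpM2r ?ler_nat // divr_ge0 ?sqr_ge0 // mulr_ge0 ?sqr_ge0 // ltW.
split=> //.
- move=> m _; rewrite one_mean normr1; split=> //.
  by have /andP[c_ge0 c_le1] := c_itv m; rewrite ger0_norm.
- by rewrite ca one_mean mulr1.
- move=> b bn ba _; rewrite one_mean mulr1.
  have /andP[-> _] := c_itv b; rewrite c_near //; clear -bn; lia.
- move=> b bn bz; rewrite one_mean mulr1.
  have /andP[c_ge0 _] := c_itv b; rewrite ger0_norm //.
  by apply: le_trans eps_h; apply: c_far; clear -bn bz; lia.
Qed.

End Localizers.

(** * Reconstruction by pairwise tests *)

Section ReconstructionFromTests.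
Variables (R : realType) (q : R).
Hypotheses (q0 : 0 < q) (q1 : q < 1).

Lemma expR_le_quadratic (y : R) : `|y| <= 2^-1 -> expR y <= 1 + y + 2 * y ^+ 2.
Proof.
move=> y_le; have : y <= `|y| by exact: ler_norm.
move=> yy; have y1 : 0 < 1 - y by lra.
have : expR y <= (1 - y)^-1.
  rewrite -[y in leLHS]opprK expRN lef_pV2 ?posrE ?expR_gt0 //.
  exact: expR_ge1Dx.
move=> /le_trans; apply; rewrite -[leLHS]mul1r ler_pdivrMr //.
rewrite (_ : _ * (1 - y) = 1 + y ^+ 2 * (1 - 2 * y)); last by ring.
by rewrite lerDl mulr_ge0 ?sqr_ge0 //; lra.
Qed.

Lemma deletion_prob_ge0 (n d : nat) (D : {set 'I_d * 'I_n}) :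
  0 <= deletion_prob q D.
Proof.
by apply: prodr_ge0 => s _; case: ifP => _; rewrite ?subr_ge0 ltW.
Qed.

Lemma sum_deletion_prob (n d : nat) :
  \sum_(D : {set 'I_d * 'I_n}) deletion_prob q D = 1.
Proof.
transitivity (\prod_(i < d) \sum_(S : {set 'I_n}) survival_prob q S * (1 : R)).
  rewrite -(deletion_prob_prod q (fun _ _ => 1)).
  by apply: eq_bigr => D _; rewrite big1 ?mulr1.
rewrite big1 // => i _.
have := @survival_subset_prob R q 'I_n finset.set0.
rewrite cards0 expr0 => e; rewrite -[RHS]e.
by apply: eq_bigr => S _; rewrite finset.sub0set.
Qed.

(** By [expR_le_quadratic], a rate [l] with [2 l M <= 1/2] gives the bound
    [1 - 2 l Delta + 8 l^2 M^2], which is least at [l = Delta / (8 M^2)]. *)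
Lemma mean_expR_le (n d : nat) (G : {set 'I_d * 'I_n} -> R) (M Delta : R) :
  0 < Delta -> Delta <= M -> (forall D, `|G D| <= 2 * M) ->
  2 * Delta <= \sum_D deletion_prob q D * G D ->
  \sum_D deletion_prob q D * expR (- (Delta / (8 * M ^+ 2)) * G D) <=
  1 - Delta ^+ 2 / (8 * M ^+ 2).
Proof.
move=> Delta0 DeltaM GM EG.
have M0 : 0 < M by exact: lt_le_trans DeltaM.
set l := Delta / (8 * M ^+ 2).
have l0 : 0 < l by rewrite divr_gt0 // mulr_gt0 // exprn_gt0.
have lM : l * (2 * M) <= 2^-1.
  rewrite (_ : l * (2 * M) = (Delta / M) * 4^-1); last by rewrite /l; field; rewrite gt_eqF.
  have : Delta / M <= 1 by rewrite ler_pdivrMr // mul1r.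
  lra.
have step D : deletion_prob q D * expR (- l * G D) <=
   deletion_prob q D * (1 + 2 * (l * (2 * M)) ^+ 2) - l * (deletion_prob q D * G D).
  rewrite [leRHS](_ : _ = deletion_prob q D * (1 + - l * G D + 2 * (l * (2 * M)) ^+ 2));
    last by ring.
  apply: (ler_wpM2l (deletion_prob_ge0 D)).
  have lG : `|- l * G D| <= l * (2 * M).
    by rewrite normrM normrN (gtr0_norm l0) ler_pM2l.
  apply: (le_trans (expR_le_quadratic (le_trans lG lM))).
  rewrite lerD2l ler_pM2l // -[leLHS]real_normK ?num_real //.
  by apply: lerXn2r; rewrite ?nnegrE // (le_trans (normr_ge0 _) lG).
apply: (le_trans (ler_sum _ (fun D _ => step D))).
rewrite sumrB -mulr_suml sum_deletion_prob mul1r -mulr_sumr.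
apply: (@le_trans _ _ (1 + 2 * (l * (2 * M)) ^+ 2 - l * (2 * Delta))).
  by rewrite lerD2l lerN2 ler_pM2l.
rewrite le_eqVlt; apply/orP; left; apply/eqP; rewrite /l; field.
by rewrite gt_eqF.
Qed.

Lemma sum_prod_deletion_prob (n d T : nat) (F : {set 'I_d * 'I_n} -> R) :
  \sum_(D : {ffun 'I_T -> {set 'I_d * 'I_n}}) \prod_t (deletion_prob q (D t) * F (D t)) =
  (\sum_D deletion_prob q D * F D) ^+ T.
Proof.
rewrite -[in RHS](card_ord T) -prodr_const.
by rewrite (bigA_distr_bigA (fun _ D => deletion_prob q D * F D)).
Qed.

(** The candidate that beats all others in total score is returned. If this is not [X], then some
    [Y] is not beaten by [X], an event of exponentially small probability in [T]; a union bound over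
    at most [2^(n^d)] candidates concludes. *)
Lemma reconstruction_from_tests (n d T : nat) (M Delta : R)
    (g : cube n d -> cube n d -> sized_hypermatrix d -> R) :
  0 < Delta -> Delta <= M ->
  (forall X Y, X <> Y -> [/\
     forall Z (D : {set 'I_d * 'I_n}), `|g X Y (trace Z D)| <= M,
     Delta <= \sum_(D : {set 'I_d * 'I_n}) deletion_prob q D * g X Y (trace X D) &
     \sum_(D : {set 'I_d * 'I_n}) deletion_prob q D * g X Y (trace Y D) <= - Delta]) ->
  exists rec : T.-tuple (sized_hypermatrix d) -> cube n d,
    forall X, 1 - (2 ^ (n ^ d))%:R * expR (- (T%:R * (Delta ^+ 2 / (8 * M ^+ 2))))
              <= success_prob q rec X.
Proof.
move=> Delta0 DeltaM tests.
(* Antisymmetrized, so that at most one candidate can win. *)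
pose G X Y U := g X Y U - g Y X U.
pose total X Y (u : T.-tuple (sized_hypermatrix d)) := \sum_(t < T) G X Y (tnth u t).
pose wins X u := [forall Y, (Y != X) ==> (0 < total X Y u)].
pose rec u : cube n d := odflt [ffun=> false] [pick X | wins X u].
have totalC X Y u : total X Y u = - total Y X u.
  by rewrite -sumrN; apply: eq_bigr => t _; rewrite opprB.
have rec_fail X u : rec u != X -> exists2 Y, Y != X & total X Y u <= 0.
  move=> recX; have [X_wins|] := boolP (wins X u); last first.
    rewrite negb_forall => /existsP[Y]; rewrite negb_imply -leNgt => /andP[YX tot].
    by exists Y.
  move: recX; rewrite /rec; case: pickP => [X' X'_wins /= X'X|/(_ X)]; last by rewrite X_wins.
  exists X' => //; have := forallP X'_wins X; rewrite eq_sym X'X /= => tot.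
  by rewrite totalC oppr_le0 ltW.
exists rec => X.
pose P (D : {ffun 'I_T -> {set 'I_d * 'I_n}}) := \prod_(t < T) deletion_prob q (D t).
have P0 D : 0 <= P D by apply: prodr_ge0 => t _; exact: deletion_prob_ge0.
have P1 : \sum_D P D = 1.
  rewrite -[RHS](expr1n _ T) -[in RHS](sum_deletion_prob n d).
  under [in RHS]eq_bigr do rewrite -[deletion_prob q _]mulr1.
  by rewrite -sum_prod_deletion_prob; apply: eq_bigr => D _; apply: eq_bigr => t _; rewrite mulr1.
pose u (D : {ffun 'I_T -> {set 'I_d * 'I_n}}) := [tuple trace X (D t) | t < T].
have -> : success_prob q rec X = 1 - \sum_(D | rec (u D) != X) P D.
  by rewrite -P1 (bigID (fun D => rec (u D) == X)) /= addrK.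
rewrite lerD2l lerN2.
pose l := Delta / (8 * M ^+ 2).
have l0 : 0 < l.
  by rewrite divr_gt0 // mulr_gt0 // exprn_gt0 // (lt_le_trans Delta0).
pose E Y D := \prod_(t < T) (deletion_prob q (D t) * expR (- l * G X Y (trace X (D t)))).
have E0 Y D : 0 <= E Y D.
  by apply: prodr_ge0 => t _; rewrite mulr_ge0 ?expR_ge0 ?deletion_prob_ge0.
(* Exponential Markov inequality, outcome by outcome: on this event the product of the exponentials
   is at least 1. *)
have PE Y D : total X Y (u D) <= 0 -> P D <= E Y D.
  move=> tot; rewrite /E big_split /= -expR_sum ler_peMr //.
  rewrite -expR0 ler_expR -mulr_sumr mulNr oppr_ge0 pmulr_rle0 //.
  move: tot; rewrite /total; under eq_bigr do rewrite tnth_mktuple.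
  exact.
apply: (@le_trans _ _ (\sum_(D : {ffun 'I_T -> {set 'I_d * 'I_n}}) \sum_(Y | Y != X) E Y D)).
  rewrite big_mkcond; apply: ler_sum => D _; case: ifP => [/rec_fail[Y YX tot]|_].
    rewrite (bigD1 Y) //= -[leLHS]addr0 lerD ?PE // sumr_ge0 //.
  by rewrite sumr_ge0.
rewrite exchange_big /=.
have rate0 : 0 <= 1 - Delta ^+ 2 / (8 * M ^+ 2).
  have M0 : 0 < M by exact: lt_le_trans DeltaM.
  rewrite subr_ge0 ler_pdivrMr ?mul1r ?mulr_gt0 ?exprn_gt0 //.
  have : Delta ^+ 2 <= M ^+ 2 by apply: lerXn2r; rewrite ?nnegrE // ltW.
  have := sqr_ge0 M; lra.
apply: (@le_trans _ _ (\sum_(Y : cube n d | Y != X) (1 - Delta ^+ 2 / (8 * M ^+ 2)) ^+ T)).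
  apply: ler_sum => Y YX.
  rewrite (sum_prod_deletion_prob T (fun D => expR (- l * G X Y (trace X D)))).
  have [gM gX gY] := tests X Y (fun e => negP YX (introT eqP (esym e))).
  have [gM' gX' gY'] := tests Y X (fun e => negP YX (introT eqP e)).
  apply: lerXn2r; rewrite ?nnegrE //.
    by apply: sumr_ge0 => D _; rewrite mulr_ge0 ?expR_ge0 ?deletion_prob_ge0.
  apply: mean_expR_le => //.
    move=> D; rewrite (le_trans (ler_normB _ _)) //.
    by have := gM X D; have := gM' X D; lra.
  under eq_bigr do rewrite mulrBr.
  rewrite sumrB; move: gX gY'; set x := \sum_D _; set y := \sum_D _; lra.
rewrite sumr_const -[leLHS]mulr_natl.
rewrite ler_pM ?exprn_ge0 ?ler_nat //; last first.
  rewrite -(mulrN T%:R) expRM_natl; apply: lerXn2r; rewrite ?nnegrE ?expR_ge0 //.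
  exact: expR_ge1Dx.
apply: leq_trans (max_card _) _.
rewrite card_ffun card_bool leq_pexp2l //.
have <- : #|{: {ffun 'I_d -> 'I_n}}| = (n ^ d)%N by rewrite card_ffun !card_ord.
pose f (h : {dffun forall i : 'I_d, 'I_n}) : {ffun 'I_d -> 'I_n} := [ffun i => h i].
apply: (@leq_card _ _ f) => h h' /ffunP hh'.
by apply/ffunP => i; have := hh' i; rewrite !ffunE.
Qed.

End ReconstructionFromTests.

(** * Reconstruction for given parameters *)

Section ReconstructionBound.
Variables (R : realType) (q : R).
Hypotheses (q0 : 0 < q) (q1 : q < 1).

Lemma separating_statistic (n d z h K : nat) (eps B : R) (X Y : cube n d) :
  (0 < z)%N -> (0 < h)%N -> (0 < K)%N -> (8 * z < n)%N ->
  2 ^- h <= eps -> q ^+ K / (1 - q ^+ 2) <= eps -> eps <= 1 -> 1 <= B ->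
  3 ^+ K / (1 - q ^+ 2) <= B ->
  expR (n%:R * (q * (pi * h%:R / z%:R) ^+ 2 / (1 - q) ^+ 2)) <= B ->
  X <> Y ->
  exists f : sized_hypermatrix d -> R,
    (forall (Z : cube n d) (D : {set 'I_d * 'I_n}),
      `|f (trace Z D)| <= (n ^ ((8 * z).+1 * d))%:R * (B ^+ 3) ^+ d) /\
    ((1 - q) ^+ (8 * z).+1) ^+ d *
      ((4 * z%:R ^+ 2)^-1 - (n ^ d)%:R * eps -
       (n ^ ((8 * z).+1 * d))%:R * (q ^+ K / (1 - q ^+ 2))) <=
    \sum_(D : {set 'I_d * 'I_n}) deletion_prob q D * f (trace X D) -
    \sum_(D : {set 'I_d * 'I_n}) deletion_prob q D * f (trace Y D).
Proof.
move=> z0 h0 K0 zn eps_h eps_K eps1 B1 B_sharp B_bump XY.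
have [k sep] := separating_pattern (8 * z) XY.
have /choice[par parP] : forall i, exists par : nat * nat * (nat -> R) * (nat -> R) * (nat -> R),
    let: (a, r, c0, c1, c2) := par in
    [/\ (a + 4 * r <= k i)%N, (k i + 4 * r <= a + 8 * z)%N, (a + 8 * z < n)%N,
        localizes q n (8 * z) (4 * z%:R ^+ 2)^-1 eps (q ^+ K / (1 - q ^+ 2))
          a r c0 c1 c2 &
        forall j, (j <= n)%N -> [/\ `|c0 j| <= B, `|c1 j| <= B & `|c2 j| <= B]].
  move=> i; have [a [r [c0 [c1 [c2 H]]]]] := localizer_exists q0 q1 z0 h0 K0 zn
    (ltn_ord (k i)) eps_h eps_K eps1 B1 B_sharp B_bump.
  by exists (a, r, c0, c1, c2).
pose a i := (par i).1.1.1.1; pose r i := (par i).1.1.1.2.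
pose c0 i := (par i).1.1.2; pose c1 i := (par i).1.2; pose c2 i := (par i).2.
have {}parP i : [/\ (a i + 4 * r i <= k i)%N, (k i + 4 * r i <= a i + 8 * z)%N,
        (a i + 8 * z < n)%N,
        localizes q n (8 * z) (4 * z%:R ^+ 2)^-1 eps (q ^+ K / (1 - q ^+ 2))
          (a i) (r i) (c0 i) (c1 i) (c2 i) &
        forall j, (j <= n)%N -> [/\ `|c0 i j| <= B, `|c1 i j| <= B & `|c2 i j| <= B]].
  by have := parP i; rewrite /a /r /c0 /c1 /c2; case: (par i) => [[[[? ?] ?] ?] ?].
have aW i : (a i + 8 * z < n)%N by case: (parP i).
have loc i : localizes q n (8 * z) (4 * z%:R ^+ 2)^-1 eps (q ^+ K / (1 - q ^+ 2))
          (a i) (r i) (c0 i) (c1 i) (c2 i) by case: (parP i).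
have eta1 : (4 * z%:R ^+ 2)^-1 <= 1 :> R.
  have z1 : 1 <= z%:R ^+ 2 :> R by rewrite exprn_ege1 // ler1n.
  rewrite invf_le1; last by apply: mulr_gt0 => //; apply: lt_le_trans z1.
  by rewrite (le_trans z1) // ler_peMl ?sqr_ge0 // ler1n.
have del0 : 0 <= q ^+ K / (1 - q ^+ 2).
  by rewrite divr_ge0 ?exprn_ge0 ?subr_ge0 ?exprn_ile1 // ltW.
have eps0 : 0 <= eps by exact: le_trans eps_K.
have del01 : 0 <= q ^+ K / (1 - q ^+ 2) <= 1 by rewrite del0 (le_trans eps_K).
have [||//|pat [w disc]] := sep a r; [by move=> i; case: (parP i)..|].
have bound (Z : cube n d) D : `|statistic n pat w c0 c1 c2 (trace Z D)| <=
    (n ^ ((8 * z).+1 * d))%:R * (B ^+ 3) ^+ d.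
  by apply: statistic_bound => i j jn; case: (parP i) => _ _ _ _ /(_ j jn)[].
case: disc => disc.
  exists (statistic n pat w c0 c1 c2); split; first exact: bound.
  exact: (mean_difference eta1 eps0 del01 q1 aW loc disc).
(* Here the pattern is that of [Y], so the sign is reversed. *)
exists (fun U => - statistic n pat w c0 c1 c2 U); split=> [Z D|]; first by rewrite normrN.
under eq_bigr do rewrite mulrN; under [X in _ <= _ - X]eq_bigr do rewrite mulrN.
rewrite !sumrN opprK [leRHS]addrC; exact: (mean_difference eta1 eps0 del01 q1 aW loc disc).
Qed.

(** The errors use up at most half of [1 / (4 z^2)], and the remaining [1 / (8 z^2)] keeps the two
    means [2 Delta] apart. Subtracting their midpoint gives a test with means of opposite signs and
    at most doubles its size, hence the factor 2 in [M]. *)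
Lemma reconstruction_bound (n d T z h K : nat) (eps B M Delta : R) :
  (0 < z)%N -> (0 < h)%N -> (0 < K)%N -> (8 * z < n)%N ->
  2 ^- h <= eps -> q ^+ K / (1 - q ^+ 2) <= eps -> eps <= 1 -> 1 <= B ->
  3 ^+ K / (1 - q ^+ 2) <= B ->
  expR (n%:R * (q * (pi * h%:R / z%:R) ^+ 2 / (1 - q) ^+ 2)) <= B ->
  (n ^ d)%:R * eps + (n ^ ((8 * z).+1 * d))%:R * (q ^+ K / (1 - q ^+ 2)) <=
    (8 * z%:R ^+ 2)^-1 ->
  M = 2 * ((n ^ ((8 * z).+1 * d))%:R * (B ^+ 3) ^+ d) ->
  Delta = ((1 - q) ^+ (8 * z).+1) ^+ d / (16 * z%:R ^+ 2) ->
  exists rec : T.-tuple (sized_hypermatrix d) -> cube n d,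
    forall X, 1 - (2 ^ (n ^ d))%:R * expR (- (T%:R * (Delta ^+ 2 / (8 * M ^+ 2))))
              <= success_prob q rec X.
Proof.
move=> z0 h0 K0 zn eps_h eps_K eps1 B1 B_sharp B_bump small ME DeltaE.
have z1 : 1 <= z%:R ^+ 2 :> R by rewrite exprn_ege1 // ler1n.
have z16 : 0 < 16 * z%:R ^+ 2 :> R by apply: mulr_gt0 => //; apply: lt_le_trans z1.
have p01 : 0 < ((1 - q) ^+ (8 * z).+1) ^+ d <= 1.
  have p0 : 0 < 1 - q by rewrite subr_gt0.
  rewrite !exprn_gt0 //= exprn_ile1 ?exprn_ge0 ?exprn_ile1 ?ltW //.
  by rewrite ltrBlDr ltrDl.
have n0 : (0 < n)%N by exact: leq_ltn_trans zn.
pose f_exists (XY : cube n d * cube n d) (f : sized_hypermatrix d -> R) :=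
  XY.1 <> XY.2 ->
  (forall (Z : cube n d) (D : {set 'I_d * 'I_n}), `|f (trace Z D)| <= M / 2) /\
  2 * Delta <= \sum_(D : {set 'I_d * 'I_n}) deletion_prob q D * f (trace XY.1 D) -
    \sum_(D : {set 'I_d * 'I_n}) deletion_prob q D * f (trace XY.2 D).
have /choice[f fP] : forall XY, exists f, f_exists XY f.
  move=> [X Y]; have [->|XY] := pselect (X = Y); first by exists (fun=> 0) => -[].
  have [f [f_bd f_sep]] := separating_statistic z0 h0 K0 zn eps_h eps_K eps1 B1
    B_sharp B_bump XY.
  exists f => _; split=> [Z D|].
    by rewrite ME mulrC mulKf //; exact: f_bd.
  apply: le_trans f_sep; rewrite DeltaE mulrCA.
  apply: ler_wpM2l; first by case/andP: p01 => /ltW.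
  have -> : 2 * (16 * z%:R ^+ 2)^-1 = (8 * z%:R ^+ 2)^-1 :> R.
    by field; rewrite pnatr_eq0 -lt0n.
  have : (4 * z%:R ^+ 2)^-1 = (8 * z%:R ^+ 2)^-1 + (8 * z%:R ^+ 2)^-1 :> R.
    by field; rewrite pnatr_eq0 -lt0n.
  by move: small; lra.
pose EX X (g : sized_hypermatrix d -> R) :=
  \sum_(D : {set 'I_d * 'I_n}) deletion_prob q D * g (trace X D).
pose g X Y U := f (X, Y) U - (EX X (f (X, Y)) + EX Y (f (X, Y))) / 2.
have Eg Z X Y : EX Z (g X Y) =
    EX Z (f (X, Y)) - (EX X (f (X, Y)) + EX Y (f (X, Y))) / 2.
  rewrite {1}/EX; under eq_bigr do rewrite mulrBr.
  by rewrite sumrB -mulr_suml sum_deletion_prob mul1r.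
have EX_le Z (F : sized_hypermatrix d -> R) e :
    (forall D : {set 'I_d * 'I_n}, `|F (trace Z D)| <= e) -> `|EX Z F| <= e.
  move=> Fe; apply: (le_trans (ler_norm_sum _ _ _)).
  apply: (@le_trans _ _ (\sum_(D : {set 'I_d * 'I_n}) deletion_prob q D * e)).
    apply: ler_sum => D _; rewrite normrM ger0_norm ?deletion_prob_ge0 //.
    by apply: ler_wpM2l; rewrite ?deletion_prob_ge0.
  by rewrite -mulr_suml sum_deletion_prob mul1r.
apply: (@reconstruction_from_tests R q q0 q1 n d T M Delta g).
- by rewrite DeltaE divr_gt0 //; case/andP: p01.
- rewrite DeltaE ME.
  have N1 : 1 <= (n ^ ((8 * z).+1 * d))%:R :> R by rewrite ler1n expn_gt0 n0.
  have Bd1 : 1 <= (B ^+ 3) ^+ d by rewrite !exprn_ege1.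
  have N1B : 1 * 1 <= (n ^ ((8 * z).+1 * d))%:R * (B ^+ 3) ^+ d :> R by apply: ler_pM.
  have : ((1 - q) ^+ (8 * z).+1) ^+ d / (16 * z%:R ^+ 2) <= 1.
    rewrite ler_pdivrMr // mul1r.
    by case/andP: p01; lra.
  by move: N1B; lra.
- move=> X Y XY; have [f_bd f_sep] := fP (X, Y) XY.
  have := EX_le X _ _ (f_bd X); have := EX_le Y _ _ (f_bd Y).
  rewrite !ler_norml => /andP[y1 y2] /andP[x1 x2].
  split=> [Z D||].
  + have := f_bd Z D; rewrite /g !ler_norml => /andP[h1 h2].
    by apply/andP; split; lra.
  + by have := Eg X X Y; rewrite /EX => ->; move: f_sep; rewrite /= -!/(EX _ _); lra.
  + by have := Eg Y X Y; rewrite /EX => ->; move: f_sep; rewrite /= -!/(EX _ _); lra.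
Qed.

End ReconstructionBound.

(** * Choice of the scale [z] and of the exponents [h] and [K] *)

Section ParameterChoices.
Variable R : realType.

Lemma expRZ_nat (x : R) (k : nat) : expR x ^+ k = expR (k%:R * x).
Proof. by rewrite expRM_natl. Qed.

Lemma expR_half_le2 : expR 2^-1 <= 2 :> R.
Proof.
apply: le_trans (expR_le_quadratic _) _; first by rewrite ger0_norm.
lra.
Qed.

Lemma ln_ge1 (n : nat) : (4 <= n)%N -> 1 <= ln n%:R :> R.
Proof.
move=> n4; have n4R : 4 <= n%:R :> R by rewrite (ler_nat R 4 n).
rewrite -ler_expR lnK ?posrE; last by lra.
rewrite (_ : 1 = 2%:R * 2^-1); last by field.
have := lerXn2r 2 _ _ expR_half_le2; rewrite expRM_natl !nnegrE expR_ge0 => /(_ isT (ler0n _ _)).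
by lra.
Qed.

(** The bound on [n * l] amounts to [l <= 4 n^(2/7)]; it turns the exponent [n (l / L)^2] of the
    bump weights into at most [4 L l]. From [n >= 300] follows [16 sqrt n < n], which leaves room
    for [8 z <= 16 L]. *)
Lemma scale_exists (n : nat) (L l : R) : (300 <= n)%N ->
  L = n%:R `^ (3 / 7) -> l = ln n%:R ->
  [/\ n%:R = expR l, 1 <= l, 1 <= L, n%:R * l <= 4 * L ^+ 3 &
    exists z : nat, [/\ (0 < z)%N, (8 * z < n)%N, L <= z%:R, z%:R <= 2 * L &
      16 * z%:R ^+ 2 <= expR (3 * l)]].
Proof.
move=> n300 LE' lE.
have n300R : 300 <= n%:R :> R by rewrite (ler_nat R 300 n).
have nR0 : 0 < n%:R :> R by lra.
have nE : n%:R = expR l by rewrite lE lnK.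
have l1 : 1 <= l by rewrite lE ln_ge1 // (leq_trans _ n300).
have LE : L = expR (3 / 7 * l) by rewrite LE' lE /powR gt_eqF.
clear LE' lE.
have L1 : 1 <= L by rewrite LE -[leLHS]expR0 ler_expR; lra.
split=> //.
  have step : l <= 4 * expR (2 / 7 * l) by have := expR_ge1Dx (2 / 7 * l); lra.
  rewrite LE nE (_ : 4 * _ = expR l * (4 * expR (2 / 7 * l))).
    by rewrite ler_pM2l ?expR_gt0.
  by rewrite [RHS]mulrCA -expRD expRZ_nat; congr (_ * expR _); field.
exists (Num.truncn L).+1.
have zL : L <= (Num.truncn L).+1%:R by rewrite ltW // truncnS_gt.
have zL2 : (Num.truncn L).+1%:R <= 2 * L.
  have : (Num.truncn L)%:R <= L by rewrite truncn_le; lra.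
  by rewrite -natr1; lra.
have zn : (8 * (Num.truncn L).+1 < n)%N.
  rewrite -(ltr_nat R) natrM.
  have sE : n%:R = expR (2^-1 * l) * expR (2^-1 * l).
    by rewrite -expRD nE; congr expR; field.
  have Ls : L <= expR (2^-1 * l) by rewrite LE ler_expR ler_pM2r; lra.
  have s16 : 16 < expR (2^-1 * l).
    rewrite ltNge; apply/negP => s_le.
    have : n%:R <= 16 * 16 :> R by rewrite sE ler_pM ?expR_ge0.
    lra.
  have : 16 * expR (2^-1 * l) < n%:R by rewrite sE ltr_pM2r ?expR_gt0.
  lra.
split=> //.
have zn' : (Num.truncn L).+1%:R <= expR l.
  by rewrite -nE ler_nat ltnW // (leq_ltn_trans _ zn) // leq_pmull.
rewrite (_ : 3 * l = l + (l + l)); last by ring.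
rewrite 2!expRD; apply: ler_pM; rewrite ?sqr_ge0 //; first by rewrite -nE; lra.
by rewrite expr2; apply: ler_pM.
Qed.

Variable q : R.
Hypotheses (q0 : 0 < q) (q1 : q < 1).

(** [K] is the integer just above [x]; the rest is [q = e^(- s)] and [3 <= e^2]. *)
Lemma sharp_parameter (s l x : R) : 0 < s -> 0 <= x -> (1 - q ^+ 2)^-1 <= expR l ->
  s = - ln q ->
  exists2 K : nat, (0 < K)%N &
    q ^+ K / (1 - q ^+ 2) <= expR (l - s * x) /\
    3 ^+ K / (1 - q ^+ 2) <= expR (l + 2 * x + 2).
Proof.
move=> s0 x0 q2l sE.
have q2 : 0 <= (1 - q ^+ 2)^-1 by rewrite invr_ge0 subr_ge0 exprn_ile1 // ltW.
have qE : q = expR (- s) by rewrite sE opprK lnK.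
clear sE; exists (Num.truncn x).+1 => //; split.
  rewrite expRD [leRHS]mulrC; apply: ler_pM => //.
    by rewrite exprn_ge0 // ltW.
  rewrite {1}qE expRZ_nat ler_expR mulrN lerN2 mulrC ler_pM2r //.
  by rewrite ltW // truncnS_gt.
rewrite -addrA expRD mulrC; apply: ler_pM; rewrite ?exprn_ge0 //.
have e2 : 3 <= expR 2 :> R by have := expR_ge1Dx (2 : R); lra.
apply: (@le_trans _ _ (expR 2 ^+ (Num.truncn x).+1)).
  by apply: lerXn2r; rewrite ?nnegrE ?expR_ge0.
rewrite expRZ_nat ler_expR -natr1.
have : (Num.truncn x)%:R <= x by rewrite truncn_le.
lra.
Qed.

Lemma bump_parameter (d n z : nat) (l L : R) : (0 < z)%N ->
  1 <= l -> 1 <= L -> L <= z%:R -> n%:R * l <= 4 * L ^+ 3 ->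
  exists2 h : nat, (0 < h)%N &
    2 ^- h <= expR (- ((d%:R + 3) * l)) /\
    expR (n%:R * (q * (pi * h%:R / z%:R) ^+ 2 / (1 - q) ^+ 2)) <=
    expR (64 * q * (2 * d%:R + 7) ^+ 2 / (1 - q) ^+ 2 * (L * l)).
Proof.
move=> z0 l1 L1 Lz nl.
have d0 : 0 <= d%:R :> R by [].
(* Twice the exponent wanted, since only [2 ^- h <= e^(- h / 2)] is used. *)
pose y := 2 * (d%:R + 3) * l.
have y0 : 0 <= y by rewrite /y mulr_ge0; lra.
exists (Num.truncn y).+1 => //.
have h_gt : y <= (Num.truncn y).+1%:R by rewrite ltW // truncnS_gt.
have h_lt : (Num.truncn y).+1%:R <= (2 * d%:R + 7) * l.
  have : (Num.truncn y)%:R <= y by rewrite truncn_le.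
  by rewrite -natr1 /y; lra.
set h := (Num.truncn y).+1 in h_gt h_lt *.
split.
  rewrite expRN lef_pV2 ?posrE ?expR_gt0 ?exprn_gt0 //.
  apply: (@le_trans _ _ (expR 2^-1 ^+ h)); last first.
    by apply: lerXn2r; rewrite ?nnegrE ?expR_ge0 // expR_half_le2.
  by rewrite expRZ_nat ler_expR; move: h_gt; rewrite /y; lra.
rewrite ler_expR.
clear h_gt; have pi4 : pi <= 4 :> R by have := pihalf_lt2 R; lra.
have pi0 := pi_ge0 R.
have hR0 : 0 <= h%:R :> R by [].
have z0R : 0 < z%:R :> R by rewrite ltr0n.
have L0 : 0 < L by exact: lt_le_trans L1.
have p0 : 0 < 1 - q by rewrite subr_gt0.
have frac : pi * h%:R / z%:R <= 4 * ((2 * d%:R + 7) * l) / L.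
  apply: ler_pM; [exact: mulr_ge0|by rewrite invr_ge0 ltW|exact: ler_pM|].
  by rewrite lef_pV2 ?posrE //; lra.
have frac0 : 0 <= pi * h%:R / z%:R :> R by rewrite divr_ge0 ?mulr_ge0.
have frac2 : (pi * h%:R / z%:R) ^+ 2 <= (4 * ((2 * d%:R + 7) * l) / L) ^+ 2.
  by apply: lerXn2r; rewrite ?nnegrE // (le_trans frac0).
apply: (@le_trans _ _ (n%:R * (q * (4 * ((2 * d%:R + 7) * l) / L) ^+ 2 / (1 - q) ^+ 2))).
  apply: ler_wpM2l => //; apply: ler_wpM2r; first by rewrite invr_ge0 sqr_ge0.
  by apply: ler_wpM2l => //; exact: ltW.
(* The factor [n l] is isolated so that it can be replaced by [4 L^3]. *)
rewrite (_ : n%:R * _ = 16 * q * (2 * d%:R + 7) ^+ 2 / (1 - q) ^+ 2 * (l / L ^+ 2) * (n%:R * l));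
  last by field; apply/andP; split; lra.
rewrite [leRHS](_ : _ = 16 * q * (2 * d%:R + 7) ^+ 2 / (1 - q) ^+ 2 * (l / L ^+ 2) * (4 * L ^+ 3));
  last by field; apply/andP; split; lra.
apply: ler_wpM2l => //; apply: mulr_ge0.
  apply: divr_ge0; last exact: sqr_ge0.
  by apply: mulr_ge0; [apply: mulr_ge0 => //; exact: ltW|exact: sqr_ge0].
by rewrite divr_ge0 ?sqr_ge0; lra.
Qed.

End ParameterChoices.

(** * Asymptotics of the number of traces *)

Section Asymptotics.
Variable R : realType.

(** As [Delta / M] is at least [e^(- m Phi)], the lower bound on [T] makes the exponent at least
    [n^(d + 2) / 8], hence at least [n^(d + 1)], which beats the [2^(n^d)] candidates. *)
Lemma failure_le (d n T : nat) (m Phi M Delta : R) : (0 < d)%N -> (8 <= n)%N ->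
  ln n%:R <= Phi -> 0 < Delta -> 0 < M -> M <= expR (m * Phi) * Delta ->
  expR ((2 * m + d%:R + 2) * Phi) <= T%:R ->
  (2 ^ (n ^ d))%:R * expR (- (T%:R * (Delta ^+ 2 / (8 * M ^+ 2)))) <=
  expR (- n%:R).
Proof.
move=> d0 n8 lPhi Delta0 M0 MDelta T_ge.
have n8R : 8 <= n%:R :> R by rewrite (ler_nat R 8 n).
have nR0 : 0 < n%:R :> R by apply: lt_le_trans n8R.
have ratio : expR (- (2 * m * Phi)) / 8 <= Delta ^+ 2 / (8 * M ^+ 2).
  rewrite invfM mulrA [leRHS]mulrAC ler_pM2r ?invr_gt0 //.
  rewrite ler_pdivlMr ?exprn_gt0 //.
  rewrite (_ : 2 * m * Phi = m * Phi + m * Phi); last by ring.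
  rewrite expRN mulrC ler_pdivrMr ?expR_gt0 // expRD -expr2 -exprMn [_ * expR _]mulrC.
  by apply: lerXn2r; rewrite ?nnegrE ?mulr_ge0 ?expR_ge0 // ltW.
have big : (n ^ d.+1)%:R <= T%:R * (Delta ^+ 2 / (8 * M ^+ 2)).
  apply: (@le_trans _ _ (expR ((2 * m + d%:R + 2) * Phi) * (expR (- (2 * m * Phi)) / 8))).
    rewrite mulrA -expRD.
    rewrite (_ : _ * Phi + _ = (d.+2)%:R * Phi); last by rewrite -addn2 natrD; ring.
    rewrite ler_pdivlMr //.
    apply: (@le_trans _ _ (expR (ln n%:R) ^+ d.+2)); last first.
      by rewrite expRZ_nat ler_expR ler_wpM2l.
    by rewrite lnK ?posrE // natrX (exprS _ d.+1) mulrC ler_wpM2r // exprn_ge0.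
  by apply: ler_pM; rewrite ?expR_ge0 ?divr_ge0 ?expR_ge0.
have two : (2 ^ (n ^ d))%:R <= expR (n ^ d)%:R :> R.
  rewrite natrX -[X in expR X]mulr1 -expRZ_nat.
  apply: lerXn2r; rewrite ?nnegrE ?expR_ge0 //.
  by have := expR_ge1Dx (1 : R); lra.
apply: (@le_trans _ _ (expR (n ^ d)%:R * expR (- (n ^ d.+1)%:R))).
  by apply: ler_pM; rewrite ?expR_ge0 // ler_expR lerN2.
rewrite -expRD ler_expR lerBlDr addrC -lerBlDr opprK -natrD ler_nat.
have nd : (n <= n ^ d)%N by rewrite -[leqLHS]expn1 leq_pexp2l // (leq_trans _ n8).
rewrite expnS; apply: (@leq_trans (2 * n ^ d)%N); first by rewrite mul2n -addnn leq_add.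
by rewrite leq_mul2r (leq_trans _ n8) ?orbT.
Qed.

Variable q : R.
Hypotheses (q0 : 0 < q) (q1 : q < 1).

Lemma reconstruction_eventually (d : nat) : (0 < d)%N ->
  exists C : R, exists N : nat, 0 < C /\
    forall n T : nat, (N <= n)%N ->
      expR (C * (n%:R `^ (3 / 7) * ln n%:R)) <= T%:R ->
      exists rec : T.-tuple (sized_hypermatrix d) -> cube n d,
        forall X, 1 - expR (- n%:R) <= success_prob q rec X.
Proof.
move=> d0.
have p0 : 0 < 1 - q by rewrite subr_gt0.
pose lam := - ln q; pose mu := - ln (1 - q).
have lam0 : 0 < lam by rewrite oppr_gt0 ln_lt0 // q0.
have mu0 : 0 < mu by rewrite oppr_gt0 ln_lt0 // p0 ltrBlDr ltrDl.
have pE : 1 - q = expR (- mu) by rewrite opprK lnK.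
have d1R : 1 <= d%:R :> R by rewrite ler1n.
(* The error [del] will be at most [e^(l - s z l)]; this [s] beats the at most [e^(9 d z l)] windows
   and leaves a factor [e^(- 3 l)]. *)
pose s : R := 10 * d%:R + 4.
have s0 : 0 < s by rewrite /s; lra.
pose kap : R := s / lam.
have kap0 : 0 < kap by rewrite divr_gt0.
pose b2 : R := 64 * q * (2 * d%:R + 7) ^+ 2 / (1 - q) ^+ 2.
have b20 : 0 <= b2.
  rewrite /b2; apply: divr_ge0; last exact: sqr_ge0.
  by apply: mulr_ge0; [apply: mulr_ge0 => //; exact: ltW|exact: sqr_ge0].
(* [4 * kap + 3] accounts for the weights from [sharp_parameter], [b2] for those from
   [bump_parameter]. *)
pose b : R := 4 * kap + 3 + b2.
have b0 : 0 < b by rewrite /b; lra.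
(* Exponent of [M / Delta] in units of [Phi]: the terms come from the factors 2 and [16 z^2], the
   number of windows, the weights, and the survival probability of a window. *)
pose m : R := 4 + 18 * d%:R + 3 * (b * d%:R) + 18 * (mu * d%:R).
have bd0 : 0 <= b * d%:R by apply: mulr_ge0 => //; exact: ltW.
have md0 : 0 <= mu * d%:R by apply: mulr_ge0 => //; exact: ltW.
have m0 : 0 < m by rewrite /m; lra.
(* The constant is the one in [failure_le]; beyond 300, the threshold makes [1 / (1 - q^2)] at most
   [n]. *)
exists (2 * m + d%:R + 2), (300 + (Num.truncn (1 - q ^+ 2)^-1).+1)%N; split.
  by lra.
move=> n T Nn; set L := _ `^ _; set l := ln _; set Phi := L * l => T_ge.
have n300 : (300 <= n)%N by apply: leq_trans Nn; rewrite leq_addr.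
have [nE l1 L1 nl [z [z0 zn zL zL2 e3]]] := scale_exists n300 (erefl L) (erefl l).
have q2n : (1 - q ^+ 2)^-1 <= expR l.
  rewrite -nE ltW //; apply: (lt_le_trans (truncnS_gt _)); rewrite ler_nat.
  by apply: leq_trans Nn; rewrite leq_addl.
clear Nn.
have l0 : 0 < l by exact: lt_le_trans l1.
have L0 : 0 < L by exact: lt_le_trans L1.
have LPhi : L <= Phi by rewrite /Phi ler_peMr // ltW.
have lPhi : l <= Phi by rewrite /Phi ler_peMl // ltW.
have Phi1 : 1 <= Phi by exact: le_trans lPhi.
have Phi0 : 0 <= Phi by exact: le_trans Phi1.
have [h h0 [eps_h B_bump']] := bump_parameter q0 q1 d z0 l1 L1 zL nl.
set eps := expR _ in eps_h.
pose x := kap * (z%:R * l).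
have zl0 : 0 <= z%:R * l by apply: mulr_ge0 => //; exact: ltW.
have zl2 : z%:R * l <= 2 * Phi by rewrite /Phi mulrA ler_wpM2r // ltW.
have x0 : 0 <= x by apply: mulr_ge0 => //; exact: ltW.
have [K K0 [del_le B_sharp']] := sharp_parameter q0 q1 lam0 x0 q2n erefl.
have lamx : lam * x = s * (z%:R * l).
  by rewrite /x /kap; field; rewrite gt_eqF.
rewrite lamx in del_le.
set del := q ^+ K / (1 - q ^+ 2) in del_le.
have z1 : 1 <= z%:R :> R by rewrite ler1n.
have zl : l <= z%:R * l by rewrite ler_peMl // ltW.
have dl0 : 0 <= d%:R * l by apply: mulr_ge0 => //; exact: ltW.
have dzl : d%:R * l <= d%:R * (z%:R * l) by rewrite ler_wpM2l.
have dzl2 : d%:R * (z%:R * l) <= 2 * (d%:R * Phi).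
  by rewrite [leRHS]mulrCA ler_wpM2l.
have eps_K : del <= eps.
  by apply: (le_trans del_le); rewrite ler_expR /s; clear -l1 zl dzl d1R dl0; lra.
have eps1 : eps <= 1.
  by rewrite /eps -[leRHS]expR0 ler_expR; clear -dl0 l0; lra.
have z16 : 0 < 16 * z%:R ^+ 2 :> R.
  by apply: mulr_gt0 => //; apply: exprn_gt0; exact: lt_le_trans z1.
have e3' : expR (- (3 * l)) <= (16 * z%:R ^+ 2)^-1.
  by rewrite expRN lef_pV2 ?posrE ?expR_gt0.
have NE : (n ^ ((8 * z).+1 * d))%:R = expR ((8 * z).+1%:R * (d%:R * l)) :> R.
  by rewrite natrX nE expRZ_nat natrM mulrA.
have z9 : (8 * z).+1%:R <= 9 * z%:R :> R by rewrite -natrM ler_nat; clear -z0; lia.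
have N_le : (8 * z).+1%:R * (d%:R * l) <= 9 * (d%:R * (z%:R * l)).
  by rewrite [d%:R * (_ * _)]mulrCA [leRHS]mulrA ler_wpM2r.
have small : (n ^ d)%:R * eps + (n ^ ((8 * z).+1 * d))%:R * del <= (8 * z%:R ^+ 2)^-1.
  have -> : (8 * z%:R ^+ 2)^-1 = (16 * z%:R ^+ 2)^-1 + (16 * z%:R ^+ 2)^-1 :> R.
    by field; rewrite pnatr_eq0 -lt0n.
  apply: lerD; apply: (le_trans _ e3').
    by rewrite natrX nE expRZ_nat /eps -expRD (_ : _ + _ = - (3 * l)) //; ring.
  apply: (@le_trans _ _ (expR ((8 * z).+1%:R * (d%:R * l)) * expR (l - s * (z%:R * l)))).
    by rewrite NE ler_pM2l ?expR_gt0.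
  by rewrite -expRD ler_expR /s; clear -N_le l1 zl dzl dl0; lra.
pose B := expR (b * Phi).
have kPhi : x <= 2 * (kap * Phi) by rewrite [leRHS]mulrCA ler_pM2l.
have b2Phi0 : 0 <= b2 * Phi by exact: mulr_ge0.
have kPhi0 : 0 <= kap * Phi by apply: mulr_ge0 => //; exact: ltW.
have B1 : 1 <= B.
  by rewrite /B -[leLHS]expR0 ler_expR mulr_ge0 // ltW.
have B_sharp : 3 ^+ K / (1 - q ^+ 2) <= B.
  apply: (le_trans B_sharp'); rewrite ler_expR /b.
  by clear -kPhi b2Phi0 Phi1 lPhi; lra.
have B_bump : expR (n%:R * (q * (pi * h%:R / z%:R) ^+ 2 / (1 - q) ^+ 2)) <= B.
  apply: (le_trans B_bump'); rewrite ler_expR -/b2 -/Phi /b.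
  by clear -kPhi0 Phi0; lra.
pose M := 2 * ((n ^ ((8 * z).+1 * d))%:R * (B ^+ 3) ^+ d).
pose Delta := ((1 - q) ^+ (8 * z).+1) ^+ d / (16 * z%:R ^+ 2).
have [rec recP] := @reconstruction_bound R q q0 q1 n d T z h K eps B M Delta
  z0 h0 K0 zn eps_h eps_K eps1 B1 B_sharp B_bump small erefl erefl.
exists rec => X; apply: le_trans (recP X); rewrite lerD2l lerN2.
have ME : M = 2 * (expR ((8 * z).+1%:R * (d%:R * l)) * expR (3 * (d%:R * (b * Phi)))).
  by rewrite /M NE /B !expRZ_nat (mulrCA d%:R 3).
have DE : Delta = expR (- (mu * ((8 * z).+1%:R * d%:R))) / (16 * z%:R ^+ 2).
  by rewrite /Delta pE !expRZ_nat; congr (expR _ / _); ring.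
apply: (@failure_le d n T m Phi) => //.
- by apply: leq_trans n300.
- by rewrite DE divr_gt0 ?expR_gt0.
- by rewrite ME !mulr_gt0 ?expR_gt0.
rewrite DE mulrA ler_pdivlMr // -expRD ME.
have two : 2 <= expR l by rewrite -nE ler_nat (leq_trans _ n300).
apply: (@le_trans _ _ (expR l * (expR ((8 * z).+1%:R * (d%:R * l)) *
    expR (3 * (d%:R * (b * Phi)))) * expR (3 * l))).
  by apply: ler_pM; rewrite ?mulr_ge0 ?expR_ge0 ?(ltW z16) // ler_pM2r ?mulr_gt0 ?expR_gt0.
rewrite -!expRD ler_expR.
have z18 : (8 * z).+1%:R <= 18 * Phi :> R.
  by clear -z9 zL2 LPhi; lra.
have z18d : mu * ((8 * z).+1%:R * d%:R) <= mu * d%:R * (18 * Phi).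
  by rewrite [_ * d%:R]mulrC mulrA ler_wpM2l.
rewrite (_ : m * Phi = 4 * Phi + 18 * (d%:R * Phi) + 3 * (d%:R * (b * Phi)) +
  mu * d%:R * (18 * Phi)); last by rewrite /m; ring.
by clear -z18d N_le dzl2 lPhi; lra.
Qed.

End Asymptotics.

(** * Passage to the limit and comparison of the exponents *)

Section TracesSuffice.
Variables (R : realType) (q : R).
Hypotheses (q0 : 0 < q) (q1 : q < 1).

Lemma min_success_prob_itv (n d T : nat) (rec : T.-tuple (sized_hypermatrix d) -> cube n d)
    (e : R) : 0 <= e -> (forall X, 1 - e <= success_prob q rec X) ->
  1 - e <= min_success_prob q rec <= 1.
Proof.
move=> e0 He; rewrite /min_success_prob bigmin_le_id andbT.
apply/bigmin_geP; split=> [|X _]; last exact: He.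
by rewrite lerBlDr lerDl.
Qed.

Lemma traces_suffice (d : nat) (phi : nat -> R) : (0 < d)%N ->
  (forall n, (4 <= n)%N -> n%:R `^ (3 / 7) * ln n%:R <= phi n) ->
  exp_O_traces_suffice q d phi.
Proof.
move=> d0 phi_ge; have [C [N [C0 recN]]] := reconstruction_eventually q0 q1 d0.
exists C => //.
have ex n : exists rec : (num_traces C phi n).-tuple (sized_hypermatrix d) -> cube n d,
    (maxn N 4 <= n)%N -> forall X, 1 - expR (- n%:R) <= success_prob q rec X.
  (* Small sides do not affect the limit and get a constant map. *)
  have [Nn|nN] := leqP (maxn N 4) n; last by exists (fun=> [ffun=> false]).
  have [|rec recP] := recN n (num_traces C phi n) (leq_trans (leq_maxl _ _) Nn); last by exists rec.
  apply: (@le_trans _ _ (expR (C * phi n))).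
    by rewrite ler_expR ler_pM2l // phi_ge // (leq_trans (leq_maxr _ _) Nn).
  rewrite /num_traces natr_absz gtr0_norm ?ceil_ge //.
  by rewrite -(ltr_int R) (lt_le_trans (expR_gt0 (C * phi n))) ?ceil_ge.
exists (fun n => sval (cid (ex n))).
apply: (@squeeze_cvgr _ _ _ _ (fun n => 1 - expR (- n%:R)) (fun=> 1)).
- near=> n; apply: min_success_prob_itv; first exact: expR_ge0.
  by apply: (svalP (cid (ex n))); near: n; exact: nbhs_infty_ge.
- rewrite -[X in _ --> X]subr0; apply: cvgB; first exact: cvg_cst.
  exact: cvgn_expR.
- exact: cvg_cst.
Unshelve. all: by end_near.
Qed.

End TracesSuffice.

Theorem theorem1p1 (R : realType) (q : R) (q0 : 0 < q) (q1 : q < 1) :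
  [/\ exp_O_traces_suffice q 2
        (fun n => n%:R `^ (3 / 7) * (ln n%:R) `^ (10 / 3)),
      exp_O_traces_suffice q 3
        (fun n => n%:R `^ (5 / 9) * (ln n%:R) `^ (5 / 2)) &
      forall d : nat, (4 <= d)%N ->
        exp_O_traces_suffice q d (fun n => n%:R `^ (3 / 5) * ln n%:R)].
Proof.
have ln1 (n : nat) : (4 <= n)%N -> 1 <= ln n%:R :> R by exact: ln_ge1.
have n1 (n : nat) : (4 <= n)%N -> 1 <= n%:R :> R.
  by move=> n4; rewrite ler1n (leq_trans _ n4).
(* From 4 on, [n] and [ln n] are at least 1, so raising their exponents from 3/7 and 1 only enlarges
   the bound. *)
have pow_le (n : nat) (a b : R) : (4 <= n)%N -> 3 / 7 <= a -> 1 <= b ->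
    n%:R `^ (3 / 7) * ln n%:R <= n%:R `^ a * (ln n%:R) `^ b.
  move=> n4 a_ge b_ge; apply: ler_pM; first exact: powR_ge0.
  - exact: le_trans (ln1 n n4).
  - by apply: ler_powR => //; exact: n1.
  - by apply: le1r_powR => //; exact: ln1.
split.
- by apply: traces_suffice => // n n4; apply: pow_le => //; lra.
- by apply: traces_suffice => // n n4; apply: pow_le => //; lra.
move=> d d4; apply: traces_suffice => // [|n n4]; first exact: leq_trans d4.
rewrite -[X in _ <= _ * X]powRr1; last by exact: le_trans (ln1 n n4).
by apply: pow_le => //; lra.
Qed.
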